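(* Let $a, b \in \mathbb{C}\setminus\{0\}$, $c>0$, $c>|a|+|b|+2$, and $0<\lambda\le1$. If $$\frac{\Gamma(c)\,\Gamma(c-|a|-|b|)}{\Gamma(c-|a|)\,\Gamma(c-|b|)}\Bigg[\frac{(|a|)_2(|b|)_4}{(c-|a|)_2(c-|a|-|b|-2)_2}\;{}_2F_1(|a|+2,|b|+4;c-|a|+2;-1)$$ $$+\frac{(\lambda+2)\,|a|\,(|b|)_2}{(c-|a|)(c-|a|-|b|-1)}\;{}_2F_1(|a|+1,|b|+2;c-|a|+1;-1)+\lambda\;{}_2F_1(|a|,|b|;c-|a|;-1)\Bigg]\le2\lambda,$$ then the function $z\,{}_3F_2\left(a,\frac b2,\frac{b+1}2;\frac c2,\frac{c+1}2;z\right)$ belongs to the class $\mathcal{C}_\lambda$.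
   Context: $\mathbb{D}=\{z\in\mathbb{C}:|z|<1\}$. $\mathcal{A}$ is the family of analytic functions $f$ on $\mathbb{D}$ of the form $f(z)=z+\sum_{n\ge2}a_nz^n$. For $\lambda>0$, $\mathcal{S}^*_\lambda=\{f\in\mathcal{A}: |zf'(z)/f(z)-1|<\lambda,\ z\in\mathbb{D}\}$ and $\mathcal{C}_\lambda=\{f\in\mathcal{A}: zf'(z)\in\mathcal{S}^*_\lambda\}$. Pochhammer symbol: $(x)_0=1$, $(x)_n=x(x+1)\cdots(x+n-1)$ for $n\ge1$. Clausen's hypergeometric function is ${}_3F_2(a,b,c;d,e;z)=\sum_{n=0}^\infty\frac{(a)_n(b)_n(c)_n}{(d)_n(e)_n(1)_n}z^n$ for $|z|<1$, with $d,e\ne0,-1,-2,\dots$. ${}_2F_1(a,b;c;z)$ is the Gauss hypergeometric function, i.e. $\sum_{n\ge0}\frac{(a)_n(b)_n}{(c)_n(1)_n}z^n$ for $|z|<1$, continued analytically to $\mathbb{C}\setminus[1,\infty)$ (so its value at $-1$ makes sense). *)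

(* Defs.v *)
From HB Require Import structures.
From mathcomp Require Import all_boot all_order all_algebra.
From mathcomp Require Import complex.
From mathcomp Require Import all_classical all_reals all_analysis.

Set Implicit Arguments.
Unset Strict Implicit.
Unset Printing Implicit Defensive.

Import Order.TTheory GRing.Theory Num.Theory.
Import numFieldNormedType.Exports.

Local Open Scope classical_set_scope.
Local Open Scope complex_scope.
Local Open Scope ring_scope.

(* Mathcomp-analysis equips every [numFieldType] with the topology of its norm,
   but this is found by inference only when the type is presented as the sort of
   a [numFieldType]; hence this name for the field of complex numbers. *)
Definition Cfield (R : realType) : numFieldType := R[i].

(* The norm of the field R[i] takes its values in R[i]. *)
Definition cmod (R : realType) (z : Cfield R) : R := complex.Re `|z|.

Definition Gamma (R : realType) (x : R) : R :=
  \int[lebesgue_measure]_(t in `]0, +oo[) (t `^ (x - 1) * expR (- t)).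

Definition pochhammer (K : numFieldType) (x : K) (n : nat) : K :=
  \prod_(i < n) (x + i%:R).

Definition power_series (K : numFieldType) (u : nat -> K) (z : K) : nat -> K :=
  series (fun n => u n * z ^+ n).

Definition coef2F1 (K : numFieldType) (a b c : K) (n : nat) : K :=
  pochhammer a n * pochhammer b n / (pochhammer c n * pochhammer 1 n).

Definition coef3F2 (K : numFieldType) (a b c d e : K) (n : nat) : K :=
  pochhammer a n * pochhammer b n * pochhammer c n /
  (pochhammer d n * pochhammer e n * pochhammer 1 n).

Definition hyp3F2 (R : realType) (a b c d e z : Cfield R) : Cfield R :=
  limn (power_series (coef3F2 a b c d e) z).

Definition unit_disc (R : realType) : set (Cfield R) := [set z | `|z| < 1].

Definition slit_plane (R : realType) : set (Cfield R) :=
  ~` [set x%:C | x in `[(1 : R), +oo[].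

Definition analytic_at (R : realType) (F : Cfield R -> Cfield R)
    (z0 : Cfield R) : Prop :=
  exists (u : nat -> Cfield R) (r : R), 0 < r /\
    forall z : Cfield R, `|z - z0| < r%:C ->
      power_series u (z - z0) @ \oo --> F z.

Definition continues2F1 (R : realType) (a b c : Cfield R)
    (F : Cfield R -> Cfield R) : Prop :=
  (forall z, slit_plane z -> analytic_at F z) /\
  (forall z, unit_disc z -> power_series (coef2F1 a b c) z @ \oo --> F z).

(* By the identity theorem all the functions in the set below coincide on the
   connected open set [slit_plane R]; the values elsewhere are not specified. *)
Definition hyp2F1 (R : realType) (a b c : Cfield R) : Cfield R -> Cfield R :=
  xget (fun=> 0) [set F | continues2F1 a b c F].

(* The sum of a power series on the whole unit disc is analytic there, and
   conversely an analytic function on the unit disc is the sum of its Taylor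
   series at 0. *)
Definition classA (R : realType) (f : Cfield R -> Cfield R) : Prop :=
  exists u : nat -> Cfield R, [/\ u 0%N = 0, u 1%N = 1 &
    forall z, unit_disc z -> power_series u z @ \oo --> f z].

(* At z = 0 the quotient z f'(z) / f(z) has a removable singularity with value
   1, so that the bound holds there; elsewhere it is understood that the
   quotient is defined, i.e. that f(z) <> 0. *)
Definition starlike_class (R : realType) (lambda : R)
    (f : Cfield R -> Cfield R) : Prop :=
  classA f /\
  forall z, unit_disc z -> z != 0 ->
    f z != 0 /\ `|z * derive1 f z / f z - 1| < lambda%:C.

Definition convex_class (R : realType) (lambda : R)
    (f : Cfield R -> Cfield R) : Prop :=
  classA f /\ starlike_class lambda (fun z => z * derive1 f z).

(* Main.v *)
(* Put A = |a|, B = |b| and T_m = (A)_m (B)_2m / ((c)_2m m!). By duplication T_m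
   dominates the modulus of the coefficient of z^(m+1), and f belongs to the
   class as soon as sum (m+1)(m+lambda) T_m <= 2 lambda. Writing
   (m+1)(m+lambda) = m(m-1) + (lambda+2) m + lambda and shifting the parameters
   reduces this sum to three values of sum T_m, each given by
     sum T_m = Gamma(c) Gamma(c-A-B) / (Gamma(c-A) Gamma(c-B)) 2F1(A, B; c-A; -1),
   which is the same Euler integral computed in two ways: expand
   (1-t^2)^(-A) = (1-t)^(-A) (1+t)^(-A) in powers of t^2, or recognize 2F1 at -1.
   All integrals are taken over (0, +oo) with t = r/(1+r), so that only linear
   changes of variable are needed.
   The value of 2F1 at -1 requires a continuation of 2F1(x, y; w; z) to the slit
   plane. For an integer N > x, the numbers (x)_n (y)_n / ((N)_n (w)_n) are the
   moments of s t under a product of two beta laws, so the mean of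
   (1 - z s t)^(-N) is such a continuation. Any other one agrees with it at -1,
   a boundary point of the unit disc, by continuity. *)

Require Import Defs.
From mathcomp Require Import all_boot all_order all_algebra.
From mathcomp Require Import complex.
From mathcomp Require Import all_classical all_reals all_analysis.
From mathcomp Require Import measurable_realfun.
From mathcomp Require Import ring lra.
Import Order.TTheory GRing.Theory Num.Theory.
Import numFieldNormedType.Exports.
Set Implicit Arguments.
Unset Strict Implicit.
Unset Printing Implicit Defensive.
Local Open Scope classical_set_scope.
Local Open Scope complex_scope.
Local Open Scope ring_scope.

(** * Integrals over the half-line *)

(** The bound [2 lambda] has the following origin. Let [P = f'] and [Q = (z f')']; the quantity to
    bound is [Q / P - 1]. If [v_m] is the coefficient of [z^(m+1)] in [f], then [Q - P] and [P - 1]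
    have the coefficients [m (m+1) v_m] and [(m+1) v_m] for [m >= 1]. Hence
    [|Q - P| + lambda |P - 1|] is at most [|z|] times the part [m >= 1] of the sum, that is, the
    whole sum less its first term [lambda]. This is below [lambda <= lambda |P - 1| + lambda |P|],
    so [|Q - P| < lambda |P|]. The condition on [c] is what the twice shifted sum needs to converge:
    [(A + 2) + (B + 4) < c + 4]. The obstacle is that [Gamma] and [hyp2F1] are given only as an
    integral and as a choice among continuations. Real identities are therefore proved in the
    extended reals with nonnegative integrands, where exchanging integrals and sums is free, and
    finiteness comes afterwards. On the complex side only bounded functions are integrated against
    an integrable weight, and the only expansion under an integral is that of [(1 - h)^(-N)], whose
    remainder is dominated by its value at a real point [x >= |h|]. *)

Section positive_half_line.
Context {R : realType}.
Local Notation mu := (@lebesgue_measure R).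
Local Notation halfline := (`]0%R, +oo[%classic : set R).

Lemma mem_halfline (x : R) : halfline x = (0 < x) :> Prop.
Proof. by rewrite /= in_itv/= andbT. Qed.

(** The right-hand side is a scaled pushforward of [mu], hence a measure. It agrees with [mu] on the
    intervals []a, b]], which determine Lebesgue measure. *)
Lemma lebesgue_measure_scale (k : R) (A : set R) : 0 < k -> measurable A ->
  mu A = (k%:E * mu ( *%R k @^-1` A))%E.
Proof.
move=> k0 mA.
pose m := mscale (NngNum (ltW k0))
  (pushforward mu ( *%R k : measurableTypeR R -> measurableTypeR R)).
have mk : measurable_fun setT ( *%R k : measurableTypeR R -> measurableTypeR R).
  exact: mulrl_measurable.
change (mu A = m mk A).
apply: lebesgue_measure_unique => //= _ [[a b]] _ <-.
rewrite /m /mscale/= /pushforward.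
have -> : *%R k @^-1` `]a, b] = `](k^-1 * a), (k^-1 * b)]%classic.
  apply/seteqP; split=> x /=; rewrite !in_itv/= => /andP[? ?]; apply/andP; split.
  - by rewrite mulrC ltr_pdivrMr// mulrC.
  - by rewrite mulrC ler_pdivlMr// mulrC.
  - by rewrite mulrC -ltr_pdivrMr// mulrC.
  - by rewrite mulrC -ler_pdivlMr// mulrC.
rewrite !lebesgue_measure_itv/= !lte_fin ltr_pM2l ?invr_gt0//.
case: ifPn => _; last by rewrite mule0.
by rewrite -!EFinD -EFinM -mulrBr mulrA divff ?mul1r// gt_eqF.
Qed.

Lemma integral_halfline_scale (k : R) (f : R -> \bar R) : 0 < k ->
  measurable_fun setT f -> (forall x, (0 <= f x)%E) ->
  (\int[mu]_(x in halfline) f x = k%:E * \int[mu]_(x in halfline) f (k * x)%R)%E.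
Proof.
move=> k0 mf f0.
have mk : measurable_fun setT ( *%R k : measurableTypeR R -> measurableTypeR R).
  exact: mulrl_measurable.
rewrite (eq_measure_integral (mscale (NngNum (ltW k0))
   (pushforward mu ( *%R k : measurableTypeR R -> measurableTypeR R)))); last first.
  by move=> A mA _; exact: lebesgue_measure_scale.
rewrite ge0_integral_mscale//; last exact: measurable_funS mf.
rewrite ge0_integral_pushforward//=; last exact: measurable_funS mf.
congr (_ * integral _ _ _)%E.
by apply/seteqP; split=> x /=; rewrite !in_itv/= !andbT pmulr_rgt0.
Qed.

(** Extension by zero outside the quadrant reduces this to Tonelli on the plane. *)
Lemma tonelli_halfline (f : R * R -> \bar R) :
  measurable_fun setT f -> (forall x, (0 <= f x)%E) ->
  (\int[mu]_(x in halfline) \int[mu]_(y in halfline) f (x, y) =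
   \int[mu]_(y in halfline) \int[mu]_(x in halfline) f (x, y))%E.
Proof.
move=> mf f0.
pose g := (f \_ (halfline `*` halfline)).
have mg : measurable_fun setT g.
  apply/(measurable_restrictT _ _).1 => //; first exact: measurableX.
  exact: measurable_funS mf.
have g0 x : (0 <= g x)%E by rewrite /g patchE; case: ifP.
have := fubini_tonelli (m1 := mu) (m2 := mu) g mg g0.
have E1 : forall x, (\int[mu]_y g (x, y) =
  ((fun x => \int[mu]_(y in halfline) f (x, y)) \_ halfline) x)%E.
  move=> x; rewrite patchE; case: ifPn => xD.
    rewrite [RHS]integral_mkcond; apply: eq_integral => y _.
    by rewrite /g !patchE in_setX xD.
  apply: integral0_eq => y _; by rewrite /g patchE in_setX (negbTE xD).
have E2 : forall y, (\int[mu]_x g (x, y) =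
  ((fun y => \int[mu]_(x in halfline) f (x, y)) \_ halfline) y)%E.
  move=> y; rewrite patchE; case: ifPn => yD.
    rewrite [RHS]integral_mkcond; apply: eq_integral => x _.
    by rewrite /g !patchE in_setX yD andbT.
  apply: integral0_eq => x _; by rewrite /g patchE in_setX (negbTE yD) andbF.
move=> fub; transitivity (\int[mu]_x \int[mu]_y g (x, y))%E.
  by rewrite integral_mkcond; apply: eq_integral => x _; rewrite -E1.
rewrite [LHS]fub [RHS]integral_mkcond.
by apply: eq_integral => y _; rewrite -E2.
Qed.

End positive_half_line.

(** * The Gamma function and the beta integral *)

Section gamma_beta.
Context {R : realType}.
Local Notation mu := (@lebesgue_measure R).
Local Notation halfline := (`]0%R, +oo[%classic : set R).

(* Unlike [Gamma], this is meaningful before finiteness is known. *)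
Definition egamma (x : R) : \bar R :=
  (\int[mu]_(t in halfline) (t `^ (x - 1) * expR (- t))%:E)%E.

Lemma GammaE (x : R) : Gamma x = fine (egamma x).
Proof. by []. Qed.

Lemma egamma_ge0 (x : R) : (0 <= egamma x)%E.
Proof.
by apply: integral_ge0 => t _; rewrite lee_fin mulr_ge0 ?powR_ge0 ?expR_ge0.
Qed.

Lemma measurable_powR_comp d (T : measurableType d) (f : T -> R) (p : R) D :
  measurable_fun D f -> measurable_fun D (fun t => f t `^ p).
Proof. by move=> mf; exact: (measurableT_comp (measurable_powR p)). Qed.

Lemma measurable_expR_comp d (T : measurableType d) (f : T -> R) D :
  measurable_fun D f -> measurable_fun D (fun t => expR (f t)).
Proof. by move=> mf; exact: measurableT_comp. Qed.

Lemma powR_gt0_add (x p q : R) : 0 < x -> x `^ p * x `^ q = x `^ (p + q).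
Proof. by move=> x0; rewrite powRD// (gt_eqF x0) implybT. Qed.

(** Scaling by [s]. No sign is imposed on [x], since both sides may be infinite. *)
Lemma integral_powR_expR (x s : R) : 0 < s ->
  (\int[mu]_(t in halfline) (t `^ (x - 1) * expR (- (s * t)))%:E =
   (s `^ (- x))%:E * egamma x)%E.
Proof.
move=> s0.
have mf (k : R) : measurable_fun setT (fun t => t `^ (x - 1) * expR (- (k * t))).
  apply: measurable_funM; first exact: measurable_powR.
  apply: measurable_expR_comp; apply: measurableT_comp => //.

rewrite /egamma [in RHS](@integral_halfline_scale _ s)//; last 2 first.
- apply/measurable_EFinP; apply: eq_measurable_fun (mf 1) => t _.
  by rewrite mul1r.
- by move=> t; rewrite lee_fin mulr_ge0 ?powR_ge0 ?expR_ge0.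
rewrite [X in (_ = _ * (_ * X))%E](_ : _ = (\int[mu]_(t in halfline)
    ((s `^ (x - 1))%:E * (t `^ (x - 1) * expR (- (s * t)))%:E))%E); last first.
  apply: eq_integral => t; rewrite inE mem_halfline => t0.
  by rewrite -EFinM powRM ?ltW// mulrA.
rewrite ge0_integralZl_EFin ?powR_ge0//; last 2 first.
- by move=> t _; rewrite lee_fin mulr_ge0 ?powR_ge0 ?expR_ge0.
- by apply/measurable_EFinP/measurable_funTS; exact: mf.
rewrite !muleA -!EFinM (_ : s `^ (- x) * s * s `^ (x - 1) = 1) ?mul1e//.
rewrite -{2}[s]powRr1 ?ltW// !powR_gt0_add// (_ : _ + _ + _ = 0) ?powRr0//.
ring.
Qed.

(** Integrate [r^(a-1) u^(a+b-1) exp(-u (1 + k r))] over the quadrant in both orders: [u] first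
    yields the left-hand side, [r] first the right-hand side. The factor [egamma (a + b)] is kept as
    a multiplier because it may still be infinite. The parameter [k] is what later produces powers
    of [1 + t]. *)
Lemma egamma_beta (a b k : R) : 0 < k ->
  (egamma (a + b) * \int[mu]_(r in halfline)
     (r `^ (a - 1) * (1 + k * r) `^ (- (a + b)))%:E =
   (k `^ (- a))%:E * (egamma a * egamma b))%E.
Proof.
move=> k0.
pose f (z : R * R) := (z.1 `^ (a - 1) *
  (z.2 `^ (a + b - 1) * expR (- (z.2 * (1 + k * z.1)))))%:E.
have mf : measurable_fun setT f.
  apply/measurable_EFinP; apply: measurable_funM.
    by apply: measurable_powR_comp; exact: measurable_fst.
  apply: measurable_funM.
    by apply: measurable_powR_comp; exact: measurable_snd.
  apply: measurable_expR_comp; apply: measurableT_comp => //.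
  apply: measurable_funM; first exact: measurable_snd.
  apply: measurable_funD; first exact: measurable_cst.
  apply: measurable_funM; first exact: measurable_cst.
  exact: measurable_fst.
have f0 z : (0 <= f z)%E.
  by rewrite lee_fin !mulr_ge0 ?powR_ge0 ?expR_ge0.
have mbeta : measurable_fun setT (fun r => r `^ (a - 1) * (1 + k * r) `^ (- (a + b))).
  apply: measurable_funM; first exact: measurable_powR.
  apply: measurable_powR_comp.
  apply: measurable_funD; first exact: measurable_cst.
  exact: mulrl_measurable.
have := tonelli_halfline mf f0.
rewrite [X in X = _ -> _](_ : _ = (egamma (a + b) * \int[mu]_(r in halfline)
     (r `^ (a - 1) * (1 + k * r) `^ (- (a + b)))%:E)%E); last first.
  rewrite -ge0_integralZl//; last 3 first.
  - by apply/measurable_EFinP/measurable_funTS.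
  - by move=> r _; rewrite lee_fin mulr_ge0 ?powR_ge0.
  - exact: egamma_ge0.
  apply: eq_integral => r; rewrite inE mem_halfline => r0.
  have kr0 : 0 < 1 + k * r by rewrite addr_gt0 ?mulr_gt0.
  rewrite /f/=; under eq_integral do rewrite EFinM [_ * (1 + k * r)]mulrC.
  rewrite ge0_integralZl_EFin ?powR_ge0//; last 2 first.
  - by move=> t _; rewrite lee_fin mulr_ge0 ?powR_ge0 ?expR_ge0.
  - apply/measurable_EFinP/measurable_funTS; apply: measurable_funM.
      exact: measurable_powR.
    apply: measurable_expR_comp; apply: measurableT_comp => //.
  by rewrite integral_powR_expR// muleA -EFinM muleC.
move=> ->.
rewrite muleA {2}/egamma.
rewrite -ge0_integralZl//; last 3 first.
- apply/measurable_EFinP/measurable_funTS; apply: measurable_funM.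
    exact: measurable_powR.
  by apply: measurable_expR_comp; exact: oppr_measurable.
- by move=> t _; rewrite lee_fin mulr_ge0 ?powR_ge0 ?expR_ge0.
- by rewrite mule_ge0 ?egamma_ge0// lee_fin powR_ge0.
apply: eq_integral => u; rewrite inE mem_halfline => u0.
rewrite /f/=.
under eq_integral.
  move=> r _.
  rewrite (_ : _ * _ = u `^ (a + b - 1) * expR (- u) *
                       (r `^ (a - 1) * expR (- (u * k * r)))); last first.
    rewrite mulrDr mulr1 opprD expRD (mulrA u k r); ring.
  rewrite EFinM; over.
rewrite ge0_integralZl_EFin ?mulr_ge0 ?powR_ge0 ?expR_ge0//; last 2 first.
- by move=> t _; rewrite lee_fin mulr_ge0 ?powR_ge0 ?expR_ge0.
- apply/measurable_EFinP/measurable_funTS; apply: measurable_funM.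
    exact: measurable_powR.
  apply: measurable_expR_comp; apply: measurableT_comp => //.
rewrite integral_powR_expR ?mulr_gt0// powRM ?ltW//.
rewrite muleA -EFinM [RHS]muleC [in RHS]muleA -EFinM.
congr ((_)%:E * _)%E.
rewrite (_ : b - 1 = a + b - 1 - a); last by ring.
by rewrite -(powR_gt0_add (a + b - 1) (- a) u0); ring.
Qed.

Lemma egamma1 : egamma 1 = 1%:E.
Proof.
rewrite /egamma.
under eq_integral => t _ do rewrite subrr powRr0 mul1r.
rewrite integral_itv_obnd_cbnd; last first.
  apply/measurable_EFinP/measurable_funTS/measurable_expR_comp.
  exact: oppr_measurable.
rewrite -[RHS](@integral_exponential_pdf R 1 ltr01) integral_mkcond.
apply: eq_integral => t _; rewrite /exponential_pdf !patchE.
by case: ifP => // _; rewrite mul1r mulN1r.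
Qed.

Lemma powRN_cvg0 (b : R) : 0 < b -> (1 + x) `^ (- b) @[x --> +oo] --> 0.
Proof.
move=> b0; apply/(@cvgrPdist_lt _ R^o) => e e0.
near=> x.
have x0 : 0 < x by near: x; exact: nbhs_pinfty_gt.
rewrite sub0r normrN ger0_norm ?powR_ge0// powRN.
rewrite invf_plt ?posrE ?powR_gt0 ?addr_gt0//.
(* Written as a [b]-th power, the bound becomes a lower bound on [x] by monotonicity. *)
have -> : e^-1 = (e^-1 `^ b^-1) `^ b.
  by rewrite -powRrM mulVf ?powRr1 ?invr_ge0 ?ltW// gt_eqF.
rewrite gt0_ltr_powR// ?nnegrE ?powR_ge0 ?addr_ge0 ?ltW//.
rewrite ltr_wpDl//; near: x; exact: nbhs_pinfty_gt.
Unshelve. all: by end_near. Qed.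

Lemma integral_powRN (b : R) : 0 < b ->
  (\int[mu]_(r in halfline) ((1 + r) `^ (- (1 + b)))%:E = (b^-1)%:E)%E.
Proof.
move=> b0.
have mF (p : R) : measurable_fun setT (fun r : R => (1 + r) `^ p).
  by apply: measurable_powR_comp; apply: measurable_funD.
rewrite integral_itv_obnd_cbnd; last exact/measurable_EFinP/measurable_funTS.
have dF (p x : R) : 0 <= x ->
  is_derive x 1 (fun r : R => (1 + r) `^ p) (p * (1 + x) `^ (p - 1)).
  move=> x0.
  have x1 : 0 < 1 + x by rewrite ltr_pwDl.
  have h1 : is_derive x 1 (fun r : R => 1 + r) (0 + 1).
    exact: (is_deriveD (is_derive_cst (1 : R) x (1 : R)) (is_derive_id x (1 : R))).
  rewrite add0r in h1.
  have := is_derive1_comp (is_derive1_powR p x1 : is_derive (1 + x) 1 _ _) h1.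
  by rewrite mulr1.
have dG (x : R) : 0 <= x ->
  is_derive x 1 (fun r : R => - b^-1 * (1 + r) `^ (- b)) ((1 + x) `^ (- (1 + b))).
  move=> x0; have ? := dF (- b) _ x0.
  apply: is_derive_eq; rewrite /GRing.scale/= mulrA mulrNN mulVf ?gt_eqF//.
  by rewrite mul1r; congr (_ `^ _); ring.
have cF (p x : R) : 0 <= x -> {for x, continuous (fun r : R => (1 + r) `^ p)}.
  move=> x0; apply: differentiable_continuous; apply/derivable1_diffP.
  by have := dF p _ x0; case.
have cG (x : R) : 0 <= x ->
    {for x, continuous (fun r : R => - b^-1 * (1 + r) `^ (- b))}.
  move=> x0; apply: differentiable_continuous; apply/derivable1_diffP.
  by have := dG _ x0; case.
rewrite (@ge0_continuous_FTC2y _ _ (fun r => - b^-1 * (1 + r) `^ (- b)) 0 0).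
- by rewrite addr0 powR1 mulr1 sub0e EFinN oppeK.
- by move=> x _; exact: powR_ge0.
- apply/continuous_within_itvcyP; split.
    by move=> x; rewrite in_itv/= andbT => /ltW; exact: cF.
  by apply: cvg_at_right_filter; exact: cF.
- by rewrite -[X in _ --> X](mulr0 (- b^-1)); apply: cvgMl_tmp; exact: powRN_cvg0.
- by move=> x /ltW x0; have := dG _ x0; case.
- by apply: cvg_at_right_filter; exact: (cG 0 (lexx _)).
- move=> x; rewrite in_itv/= andbT => /ltW x0.
  by rewrite derive1E; have := dG _ x0; case.
Qed.

(* The case [a = 1] of the beta integral, which is elementary, replaces an
   integration by parts that would be singular at 0 when [b < 1]. *)
Lemma egammaS (b : R) : 0 < b -> egamma (b + 1) = (b%:E * egamma b)%E.
Proof.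
move=> b0; have := @egamma_beta 1 b 1 ltr01.
under eq_integral => r r0.
  rewrite subrr powRr0 !mul1r; over.
rewrite integral_powRN// egamma1 powR1 !mul1e => <-.
by rewrite muleCA -EFinM divff ?gt_eqF// mule1 addrC.
Qed.

(** At [b + 1] the exponent of [t] is [b > 0], so the integrand is at least [exp(-2)] on [[1, 2]];
    [egammaS] carries positivity back to [b]. *)
Lemma egamma_gt0 (b : R) : 0 < b -> (0 < egamma b)%E.
Proof.
move=> b0.
suff : (0 < egamma (b + 1))%E.
  by rewrite egammaS// !lt0e mule_eq0 negb_or => /andP[/andP[_ ->] _]; rewrite egamma_ge0.
have mG (p : R) : measurable_fun setT (fun t : R => t `^ p * expR (- t)).
  apply: measurable_funM; first exact: measurable_powR.
  by apply: measurable_expR_comp; exact: oppr_measurable.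
have : ((expR (- 2))%:E <= egamma (b + 1))%E.
  apply: (@le_trans _ _ (\int[mu]_(t in `[1%R, 2%R]) (t `^ b * expR (- t))%:E)%E).
    rewrite -[leLHS]mule1.
    rewrite [X in (_ * X)%E](_ : _ = mu `[1%R, 2%R]); last first.
      rewrite lebesgue_measure_itv/= lte_fin ltr1n -EFinD; congr EFin; lra.
    rewrite -integral_cst//; apply: ge0_le_integral => //.
    - by move=> ? _; rewrite lee_fin expR_ge0.
    - by apply/measurable_EFinP/measurable_funTS; exact: mG.
    - move=> x /=; rewrite in_itv/= => /andP[x1 x2].
      rewrite lee_fin -[leLHS]mul1r ler_pM ?expR_ge0 ?ler_expR ?lerN2//.
      rewrite -[leLHS](_ : 1 `^ b = 1); last by rewrite powR1.
      by rewrite ge0_ler_powR ?nnegrE ?(ltW b0) ?(le_trans ler01 x1).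
  rewrite /egamma addrK; apply: ge0_subset_integral => //.
  - by apply/measurable_EFinP/measurable_funTS; exact: mG.
  - by move=> x _; rewrite lee_fin mulr_ge0 ?powR_ge0 ?expR_ge0.
  - by move=> x /=; rewrite !in_itv/= andbT => /andP[+ _]; exact: lt_le_trans.
by apply: lt_le_trans; rewrite lte_fin expR_gt0.
Qed.

Lemma egamma_natS (n : nat) : (egamma n.+1%:R < +oo)%E.
Proof.
elim: n => [|n IH]; first by rewrite egamma1 ltry.
rewrite -natr1 egammaS//.
by move: IH (egamma_ge0 n.+1%:R); case: (egamma _) => //= r _ _; rewrite ltry.
Qed.

End gamma_beta.

Section gamma_beta2.
Context {R : realType}.
Local Notation mu := (@lebesgue_measure R).
Local Notation halfline := (`]0%R, +oo[%classic : set R).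

(** After passing to [b + 1], the power [t^b] is at most [1 + t^(n+1)] with [n] the integer part of
    [b], and [egamma] is finite at positive integers. *)
Lemma egamma_lty (b : R) : 0 < b -> (egamma b < +oo)%E.
Proof.
move=> b0.
suff : (egamma (b + 1) < +oo)%E.
  rewrite egammaS//; move: (egamma_ge0 b); case: (egamma b) => //= [r|] _.
    by rewrite !ltry.
  by rewrite gt0_muley// lte_fin.
have mG (p : R) : measurable_fun setT (fun t : R => (t `^ p * expR (- t))%:E).
  apply/measurable_EFinP; apply: measurable_funM; first exact: measurable_powR.
  by apply: measurable_expR_comp; exact: oppr_measurable.
have g0 (p t : R) : (0 <= (t `^ p * expR (- t))%:E)%E.
  by rewrite lee_fin mulr_ge0 ?powR_ge0 ?expR_ge0.
set n := Num.truncn b.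
apply: (@le_lt_trans _ _ (egamma 1 + egamma n.+2%:R)%E); last first.
  by apply: lte_add_pinfty; [rewrite egamma1 ltry|exact: egamma_natS].
rewrite /egamma -ge0_integralD//; last 2 first.
- apply: measurable_funTS; exact: mG.
- apply: measurable_funTS; exact: mG.
apply: ge0_le_integral => //.
- apply: measurable_funTS; exact: mG.
- by apply: emeasurable_funD; apply: measurable_funTS; exact: mG.
move=> t; rewrite mem_halfline => t0.
rewrite -EFinD lee_fin -mulrDl ler_pM2r ?expR_gt0// subrr powRr0 addrK.
have [t1|t1] := leP t 1.
  rewrite ler_wpDr ?powR_ge0// -[leRHS](_ : 1 `^ b = 1); last by rewrite powR1.
  by rewrite ge0_ler_powR ?nnegrE// ltW.
have -> : n.+2%:R - 1 = n.+1%:R :> R by rewrite -natr1 addrK.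
by rewrite ler_wpDl// ler_powR ?(ltW t1)// ltW// truncnS_gt.
Qed.

Lemma egammaE (b : R) : 0 < b -> egamma b = (Gamma b)%:E.
Proof.
move=> b0; rewrite GammaE fineK// ge0_fin_numE ?egamma_ge0//.
exact: egamma_lty.
Qed.

Lemma Gamma_gt0 (b : R) : 0 < b -> 0 < Gamma b.
Proof. by move=> b0; rewrite -lte_fin -egammaE// egamma_gt0. Qed.

Lemma GammaS (b : R) : 0 < b -> Gamma (b + 1) = b * Gamma b.
Proof.
by move=> b0; apply: EFin_inj; rewrite EFinM -!egammaE ?addr_gt0// egammaS.
Qed.

Lemma Gamma_beta (a b k : R) : 0 < a -> 0 < b -> 0 < k ->
  (\int[mu]_(r in halfline) (r `^ (a - 1) * (1 + k * r) `^ (- (a + b)))%:E =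
   (k `^ (- a) * (Gamma a * Gamma b / Gamma (a + b)))%:E)%E.
Proof.
move=> a0 b0 k0; have := egamma_beta a b k0.
rewrite !egammaE ?addr_gt0// => h.
have G0 : Gamma (a + b) != 0 by rewrite gt_eqF// Gamma_gt0// addr_gt0.
move: h; set I := integral _ _ _ => h.
have : I = (((Gamma (a + b))^-1)%:E * ((Gamma (a + b))%:E * I))%E.
  by rewrite muleA -EFinM mulVf// mul1e.
move=> ->; rewrite h -!EFinM; congr EFin.
by move: (Gamma a) (Gamma b) (Gamma _) => *; ring.
Qed.

End gamma_beta2.

(** * Complex series *)

Section complex_modulus.
Context {R : realType}.
Implicit Types z w : Cfield R.

Lemma normCE z : `|z| = (cmod z)%:C.
Proof. by []. Qed.

Lemma cmodE z : cmod z = Num.sqrt (complex.Re z ^+ 2 + complex.Im z ^+ 2).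
Proof. by rewrite /cmod normc_def. Qed.

Lemma cmod_ge0 z : 0 <= cmod z.
Proof. by rewrite -ler0c -normCE normr_ge0. Qed.

Lemma cmodM z w : cmod (z * w) = cmod z * cmod w.
Proof. by apply: complexI; rewrite rmorphM/= -!normCE normrM. Qed.

Lemma cmodD z w : cmod (z + w) <= cmod z + cmod w.
Proof. by rewrite -lecR rmorphD/= -!normCE ler_normD. Qed.

Lemma cmodN z : cmod (- z) = cmod z.
Proof. by rewrite /cmod normrN. Qed.

Lemma cmodB z w : cmod (z - w) = cmod (w - z).
Proof. by rewrite /cmod distrC. Qed.

Lemma cmodV z : cmod z^-1 = (cmod z)^-1.
Proof. by apply: complexI; rewrite fmorphV/= -!normCE normfV. Qed.

Lemma cmod0 : cmod (0 : Cfield R) = 0.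
Proof. by apply: complexI; rewrite -normCE normr0. Qed.

Lemma cmod1 : cmod (1 : Cfield R) = 1.
Proof. by apply: complexI; rewrite -normCE normr1. Qed.

Lemma cmodX z n : cmod (z ^+ n) = cmod z ^+ n.
Proof.
by elim: n => [|n IH]; rewrite ?expr0 ?cmod1// !exprS cmodM IH.
Qed.

Lemma cmod_eq0 z : (cmod z == 0) = (z == 0).
Proof.
by rewrite -[RHS]normr_eq0 normCE -(inj_eq (@complexI R)).
Qed.

Lemma cmod_gt0 z : (0 < cmod z) = (z != 0).
Proof. by rewrite lt0r cmod_ge0 andbT cmod_eq0. Qed.

Lemma cmodR (x : R) : cmod (x%:C : Cfield R) = `|x|.
Proof. by rewrite cmodE/= expr0n/= addr0 sqrtr_sqr. Qed.

Lemma cmod_sum (I : Type) (r : seq I) (P : pred I) (F : I -> Cfield R) :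
  cmod (\sum_(i <- r | P i) F i) <= \sum_(i <- r | P i) cmod (F i).
Proof.
elim/big_rec2: _ => [|i y x _ h]; first by rewrite cmod0.
by rewrite (le_trans (cmodD _ _))// lerD2l.
Qed.

Lemma Re_le_cmod z : `|complex.Re z| <= cmod z.
Proof. by rewrite -lecR -normCE; exact: normc_ge_Re. Qed.

Lemma Im_le_cmod z : `|complex.Im z| <= cmod z.
Proof.
by rewrite cmodE -sqrtr_sqr ler_wsqrtr// lerDr sqr_ge0.
Qed.

Lemma cmod_le_ReIm z : cmod z <= `|complex.Re z| + `|complex.Im z|.
Proof.
rewrite cmodE -[leRHS]ger0_norm ?addr_ge0// -[leRHS]sqrtr_sqr ler_wsqrtr//.
rewrite sqrrD !real_normK ?num_real// -addrA lerD2l lerDr.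
by rewrite mulrn_wge0// mulr_ge0.
Qed.

(** The radii of balls are positive elements of [R[i]]; in its order these are exactly the positive
    reals, so real radii suffice. *)
Lemma cvgCP (T : Type) (F : set_system T) (FF : Filter F) (f : T -> Cfield R)
    (l : Cfield R) :
  f @ F --> l <-> (forall e : R, 0 < e -> \forall x \near F, cmod (l - f x) < e).
Proof.
split.
  move=> /cvgrPdist_lt h e e0; have := h e%:C; rewrite ltcR => /(_ e0).
  by apply: filterS => x; rewrite normCE ltcR.
move=> h; apply/cvgrPdist_lt => -[e e'] eps0.
move: (eps0); rewrite ltcE/= => /andP[/eqP e'0 e0]; subst e'.
have := h e e0; apply: filterS => x.
by rewrite normCE -ltcR.
Qed.

Lemma cvgC_eq (u : nat -> Cfield R) (l1 l2 : Cfield R) :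
  u @ \oo --> l1 -> u @ \oo --> l2 -> l1 = l2.
Proof. by apply: cvg_unique; exact: norm_hausdorff. Qed.

Lemma cvg_cmod_le (u : nat -> Cfield R) (l z0 : Cfield R) (M : R) :
  u @ \oo --> l -> (\forall n \near \oo, cmod (z0 - u n) <= M) ->
  cmod (z0 - l) <= M.
Proof.
move=> /cvgCP h uM; apply/ler_addgt0Pr => e e0.
have [N _ hN] := h e e0; have [N' _ hN'] := uM.
have h1 := hN (maxn N N') (leq_maxl _ _).
have h2 := hN' (maxn N N') (leq_maxr _ _).
rewrite (_ : z0 - l = (z0 - u (maxn N N')) + (u (maxn N N') - l)); last first.
  by rewrite addrA subrK.
rewrite (le_trans (cmodD _ _))// lerD// cmodB; exact: ltW.
Qed.

Lemma cvgC_ReIm (u : nat -> Cfield R) (a b : R) :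
  (fun n => complex.Re (u n)) @ \oo --> a ->
  (fun n => complex.Im (u n)) @ \oo --> b ->
  u @ \oo --> (a +i* b : Cfield R).
Proof.
move=> /(@cvgrPdist_lt _ R^o) ha /(@cvgrPdist_lt _ R^o) hb; apply/cvgCP => e e0.
have e20 : 0 < e / 2 by rewrite divr_gt0.
near=> n.
rewrite (le_lt_trans (cmod_le_ReIm _))// (splitr e) ltrD//.
- rewrite (_ : complex.Re _ = a - complex.Re (u n)); last by case: (u n).
  by near: n; exact: ha.
- rewrite (_ : complex.Im _ = b - complex.Im (u n)); last by case: (u n).
  by near: n; exact: hb.
Unshelve. all: by end_near. Qed.

Lemma ReD z w : complex.Re (z + w) = complex.Re z + complex.Re w.
Proof. by case: z w => [? ?] [? ?]. Qed.

Lemma ImD z w : complex.Im (z + w) = complex.Im z + complex.Im w.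
Proof. by case: z w => [? ?] [? ?]. Qed.

Lemma Re_sum (I : Type) (r : seq I) (P : pred I) (F : I -> Cfield R) :
  complex.Re (\sum_(i <- r | P i) F i) = \sum_(i <- r | P i) complex.Re (F i).
Proof. by apply: big_morph => // z w; exact: ReD. Qed.

Lemma Im_sum (I : Type) (r : seq I) (P : pred I) (F : I -> Cfield R) :
  complex.Im (\sum_(i <- r | P i) F i) = \sum_(i <- r | P i) complex.Im (F i).
Proof. by apply: big_morph => // z w; exact: ImD. Qed.

(** Completeness is used only for [R], on real and imaginary parts separately. *)
Lemma abs_cvg_series (u : nat -> Cfield R) :
  cvgn (series (fun n => cmod (u n))) -> exists l : Cfield R, series u @ \oo --> l.
Proof.
move=> cu.
have cRe : cvgn (series (fun n => complex.Re (u n))).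
  apply: normed_cvg; apply: series_le_cvg cu => n //=; first exact: cmod_ge0.
  exact: Re_le_cmod.
have cIm : cvgn (series (fun n => complex.Im (u n))).
  apply: normed_cvg; apply: series_le_cvg cu => n //=; first exact: cmod_ge0.
  exact: Im_le_cmod.
exists (limn (series (fun n => complex.Re (u n))) +i*
        limn (series (fun n => complex.Im (u n)))).
apply: cvgC_ReIm.
- by under eq_fun do rewrite /series/= Re_sum.
- by under eq_fun do rewrite /series/= Im_sum.
Qed.

End complex_modulus.

(** * The series of [(1 - h)^(-N)] for a natural number [N], and its remainder *)

Section binomial_series.

(** This is the coefficient of [h^n] in [(1 - h)^(-N)]. The field is a parameter so that real and
    complex remainders can be compared. *)
Definition bincoef (K : numFieldType) (N n : nat) : K :=
  pochhammer (N%:R : K) n / pochhammer 1 n.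

Lemma pochhammer0 (K : numFieldType) (x : K) : pochhammer x 0 = 1.
Proof. by rewrite /pochhammer big_ord0. Qed.

Lemma pochhammerS (K : numFieldType) (x : K) n :
  pochhammer x n.+1 = pochhammer x n * (x + n%:R).
Proof. by rewrite /pochhammer big_ord_recr. Qed.

Lemma pochhammerSl (K : numFieldType) (x : K) n :
  pochhammer x n.+1 = x * pochhammer (x + 1) n.
Proof.
rewrite /pochhammer big_ord_recl addr0; congr (_ * _).
by apply: eq_bigr => i _; rewrite /bump/= natrD addrA.
Qed.

Lemma pochhammer_gt0 (K : numFieldType) (x : K) n : 0 < x -> 0 < pochhammer x n.
Proof.
by move=> x0; apply: prodr_gt0 => i _; rewrite ltr_wpDr.
Qed.

Lemma pochhammer_ge0 (K : numFieldType) (x : K) n : 0 <= x -> 0 <= pochhammer x n.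
Proof.
by move=> x0; apply: prodr_ge0 => i _; rewrite addr_ge0.
Qed.

Lemma pochhammer1 (K : numFieldType) n : pochhammer (1 : K) n = n`!%:R.
Proof.
elim: n => [|n IH]; first by rewrite pochhammer0.
by rewrite pochhammerS IH factS mulnC natrM nat1r.
Qed.

Lemma pochhammer1_neq0 (K : numFieldType) n : pochhammer (1 : K) n != 0.
Proof. by rewrite gt_eqF// pochhammer_gt0. Qed.

Lemma pochhammer_rmorph (K L : numFieldType) (f : {rmorphism K -> L}) x n :
  f (pochhammer x n) = pochhammer (f x) n.
Proof.
by rewrite rmorph_prod; apply: eq_bigr => i _; rewrite rmorphD rmorph_nat.
Qed.

Lemma bincoef_rmorph (K L : numFieldType) (f : {rmorphism K -> L}) N n :
  f (bincoef K N n) = bincoef L N n.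
Proof.
by rewrite fmorph_div !pochhammer_rmorph rmorph_nat rmorph1.
Qed.

Variable K : numFieldType.
Implicit Type h : K.

Lemma bincoef_ge0 N n : 0 <= bincoef K N n.
Proof. by rewrite divr_ge0// pochhammer_ge0. Qed.

Lemma bincoefN0 N : bincoef K N 0 = 1.
Proof. by rewrite /bincoef !pochhammer0 divr1. Qed.

Lemma bincoef0S n : bincoef K 0 n.+1 = 0.
Proof. by rewrite /bincoef pochhammerSl !mul0r. Qed.

Lemma bincoefSS N n : bincoef K N.+1 n.+1 = bincoef K N n.+1 + bincoef K N.+1 n.
Proof.
rewrite /bincoef pochhammerS (pochhammerSl N%:R) !pochhammerS.
rewrite -natr1.
have := pochhammer1_neq0 K n.
have : 1 + n%:R != 0 :> K by rewrite gt_eqF// ltr_wpDr.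
by move=> ? ?; field; apply/andP; split.
Qed.

Definition binsum (N M : nat) h : K := \sum_(n < M) bincoef K N n * h ^+ n.

Definition binrem (N M : nat) h : K := (1 - h) ^- N - binsum N M h.

(** Pascal's rule [bincoefSS] makes multiplication by [1 - h] telescope, up to one boundary term. *)
Lemma binsumS N M h : (1 - h) * binsum N.+1 M.+1 h =
  binsum N M.+1 h - bincoef K N.+1 M * h ^+ M.+1.
Proof.
elim: M => [|M IH].
  by rewrite /binsum !big_ord_recr !big_ord0/= !bincoefN0; ring.
rewrite /binsum big_ord_recr/= mulrDr -/(binsum _ _ _) IH.
rewrite [in RHS]big_ord_recr/= -/(binsum _ _ _) bincoefSS !exprS; ring.
Qed.

Lemma binrem0 M h : binrem 0 M.+1 h = 0.
Proof.
rewrite /binrem /binsum big_ord_recl bincoefN0 big1 => [|i _].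
  by rewrite !expr0 invr1; ring.
by rewrite bincoef0S mul0r.
Qed.

(** This recursion on [N] starts from a zero remainder. Sign, limit and domination of the remainder
    all follow from it by induction, without differentiation. *)
Lemma binremS N M h : 1 - h != 0 -> binrem N.+1 M.+1 h =
  (1 - h)^-1 * (binrem N M.+1 h + bincoef K N.+1 M * h ^+ M.+1).
Proof.
move=> h1; apply: (mulfI h1); rewrite mulVKf// /binrem mulrBr binsumS.
by rewrite exprS invfM mulVKf//; ring.
Qed.

End binomial_series.

Section binomial_remainder.
Context {R : realType}.

Lemma binrem_ge0 N M (x : R) : 0 <= x < 1 -> 0 <= binrem N M.+1 x.
Proof.
move=> /andP[x0 x1]; elim: N => [|N IH]; first by rewrite binrem0.
rewrite binremS; last by rewrite gt_eqF// subr_gt0.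
rewrite mulr_ge0 ?invr_ge0 ?subr_ge0 ?(ltW x1)// addr_ge0//.
by rewrite mulr_ge0 ?exprn_ge0// bincoef_ge0.
Qed.

(** For [y] strictly between [x] and [1], nonnegativity of the remainder at [y] gives
    [bincoef R N n * y^n <= (1 - y)^(-N)], leaving the geometric factor [(x / y)^n]. *)
Lemma bincoef_expr_cvg0 N (x : R) : 0 <= x < 1 ->
  (fun n => bincoef R N n * x ^+ n) @ \oo --> (0 : R).
Proof.
move=> /andP[x0 x1].
pose y := (1 + x) / 2.
have y0 : 0 < y by rewrite /y; lra.
have y1 : y < 1 by rewrite /y; lra.
have xy : x < y by rewrite /y; lra.
have bd n : bincoef R N n <= (1 - y) ^- N / y ^+ n.
  rewrite ler_pdivlMr ?exprn_gt0//.
  have := @binrem_ge0 N n y; rewrite (ltW y0) y1 => /(_ isT).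
  rewrite /binrem subr_ge0; apply: le_trans.
  rewrite /binsum big_ord_recr/= lerDr sumr_ge0// => i _.
  by rewrite mulr_ge0 ?exprn_ge0 ?bincoef_ge0// ltW.
have geo : (fun n => (1 - y) ^- N * (x / y) ^+ n) @ \oo --> (0 : R).
  rewrite -[X in _ --> X](mulr0 ((1 - y) ^- N)); apply: cvgMl_tmp.
  apply: cvg_expr; rewrite ger0_norm ?(divr_ge0 x0 (ltW y0))//.
  by rewrite ltr_pdivrMr// mul1r.
apply: (squeeze_cvgr _ (cvg_cst (0 : R)) geo).
apply: nearW => n; rewrite mulr_ge0 ?bincoef_ge0 ?exprn_ge0//=.
rewrite expr_div_n [leRHS](_ : _ = (1 - y) ^- N / y ^+ n * x ^+ n).
  by rewrite ler_wpM2r ?exprn_ge0.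
by rewrite mulrA mulrAC.
Qed.

Lemma binrem_cvg0 N (x : R) : 0 <= x < 1 ->
  (fun M => binrem N M x) @ \oo --> (0 : R).
Proof.
move=> x01; have /andP[x0 x1] := x01.
suff h : (fun M => binrem N M.+1 x) @ \oo --> (0 : R).
  by rewrite -cvg_shiftS.
elim: N => [|N IH].
  by under eq_fun do rewrite binrem0; exact: cvg_cst.
have -> : (fun M => binrem N.+1 M.+1 x) = (fun M => (1 - x)^-1 *
    (binrem N M.+1 x + x * (bincoef R N.+1 M * x ^+ M))).
  apply/funext => M; rewrite binremS ?gt_eqF ?subr_gt0//.
  by rewrite exprS mulrCA.
rewrite -[X in _ --> X](mulr0 (1 - x)^-1); apply: cvgMl_tmp.
rewrite -[X in _ --> X](addr0 0); apply: cvgD; first exact: IH.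
rewrite -[X in _ --> X](mulr0 x); apply: cvgMl_tmp.
exact: bincoef_expr_cvg0.
Qed.

(** The recursion [binremS] has nonnegative coefficients, and [|1 - h| >= 1 - x]. The bound is
    uniform in [h], so it can be integrated. *)
Lemma cmod_binrem N M (h : Cfield R) (x : R) : cmod h <= x -> x < 1 ->
  cmod (binrem N M.+1 h) <= binrem N M.+1 x.
Proof.
move=> hx x1.
have x0 : 0 <= x := le_trans (cmod_ge0 h) hx.
have h1 : 1 - x <= cmod (1 - h).
  rewrite lerBlDr -{1}(cmod1 (R := R)) -{1}(subrK h 1).
  by rewrite (le_trans (cmodD _ _))// lerD2l.
have h10 : 0 < cmod (1 - h) by rewrite (lt_le_trans _ h1)// subr_gt0.
elim: N => [|N IH]; first by rewrite !binrem0 cmod0.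
rewrite !binremS; last 2 first.
- by rewrite gt_eqF// subr_gt0.
- by rewrite -cmod_gt0.
rewrite cmodM cmodV ler_pM ?invr_ge0 ?cmod_ge0//.
  by rewrite lef_pV2 ?posrE// subr_gt0.
rewrite (le_trans (cmodD _ _))// lerD// cmodM cmodX.
rewrite -(bincoef_rmorph (real_complex R : {rmorphism R -> Cfield R})).
rewrite cmodR ger0_norm ?bincoef_ge0// ler_wpM2l ?bincoef_ge0//.
by rewrite lerXn2r ?nnegrE ?cmod_ge0.
Qed.

End binomial_remainder.

(** * Analytic continuation of 2F1 *)

Section complex_integral.
Context {R : realType} d (T : measurableType d) (mu : {measure set T -> \bar R}).
Variables (D : set T) (W : T -> R).
Hypothesis mD : measurable D.
Hypothesis W_ge0 : forall t, D t -> 0 <= W t.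
Hypothesis iW : mu.-integrable D (EFin \o W).
Implicit Types f g : T -> Cfield R.

Definition cmeasurable f :=
  measurable_fun D (fun t => complex.Re (f t)) /\
  measurable_fun D (fun t => complex.Im (f t)).

Definition cbounded f (M : R) := forall t, D t -> cmod (f t) <= M.

(** The weight is part of the integral, so that integrability of [W] once and for all makes every
    bounded measurable [f] integrable. *)
Definition cintegral f : Cfield R :=
  (\int[mu]_(t in D) (W t * complex.Re (f t))) +i*
  (\int[mu]_(t in D) (W t * complex.Im (f t))).

Lemma cmeasurable_cst (c : Cfield R) : cmeasurable (fun=> c).
Proof. by split; exact: measurable_cst. Qed.

Lemma cmeasurable_real (r : T -> R) : measurable_fun D r ->
  cmeasurable (fun t => (r t)%:C).
Proof. by move=> mr; split => //=; exact: measurable_cst. Qed.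

Lemma cmeasurableD f g : cmeasurable f -> cmeasurable g ->
  cmeasurable (fun t => f t + g t).
Proof.
move=> [mf mf'] [mg mg']; split.
- by under eq_fun do rewrite ReD; exact: measurable_funD.
- by under eq_fun do rewrite ImD; exact: measurable_funD.
Qed.

Lemma cmeasurableM f g : cmeasurable f -> cmeasurable g ->
  cmeasurable (fun t => f t * g t).
Proof.
move=> [mf mf'] [mg mg']; split.
- rewrite (_ : (fun t => _) = (fun t => complex.Re (f t) * complex.Re (g t) -
      complex.Im (f t) * complex.Im (g t))); last first.
    by apply/funext => t; case: (f t) (g t) => [? ?] [? ?].
  by apply: measurable_funB; exact: measurable_funM.
- rewrite (_ : (fun t => _) = (fun t => complex.Re (f t) * complex.Im (g t) +
      complex.Im (f t) * complex.Re (g t))); last first.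
    by apply/funext => t; case: (f t) (g t) => [? ?] [? ?].
  by apply: measurable_funD; exact: measurable_funM.
Qed.

Lemma cmeasurableN f : cmeasurable f -> cmeasurable (fun t => - f t).
Proof.
move=> mf; under eq_fun do rewrite -mulN1r.
by apply: cmeasurableM => //; exact: cmeasurable_cst.
Qed.

Lemma cmeasurableB f g : cmeasurable f -> cmeasurable g ->
  cmeasurable (fun t => f t - g t).
Proof. by move=> mf mg; apply: cmeasurableD => //; exact: cmeasurableN. Qed.

Lemma cmeasurableX f n : cmeasurable f -> cmeasurable (fun t => f t ^+ n).
Proof.
move=> mf; elim: n => [|n IH]; first exact: cmeasurable_cst.
by under eq_fun do rewrite exprS; exact: cmeasurableM.
Qed.

Lemma cmeasurableV f : cmeasurable f -> cmeasurable (fun t => (f t)^-1).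
Proof.
move=> [mf mf'].
(* The inverse of the squared modulus is expressed by [powR], which is measurable as a total
   function. *)
have mn : measurable_fun D (fun t =>
    (complex.Re (f t) ^+ 2 + complex.Im (f t) ^+ 2) `^ (-1)).
  apply: (measurableT_comp (measurable_powR (-1))).
  by apply: measurable_funD; exact: measurable_funX.
split.
- rewrite (_ : (fun t => _) = (fun t => complex.Re (f t) *
      (complex.Re (f t) ^+ 2 + complex.Im (f t) ^+ 2) `^ (-1))).
    exact: measurable_funM.
  apply/funext => t; rewrite powR_inv1 ?addr_ge0 ?sqr_ge0//.
  by case: (f t).
- rewrite (_ : (fun t => _) = (fun t => - complex.Im (f t) *
      (complex.Re (f t) ^+ 2 + complex.Im (f t) ^+ 2) `^ (-1))).
    by apply: measurable_funM => //; exact: measurableT_comp.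
  apply/funext => t; rewrite powR_inv1 ?addr_ge0 ?sqr_ge0//.
  by case: (f t) => x y /=; rewrite mulNr.
Qed.

Let le_integrable_weight (r : T -> R) (M : R) : measurable_fun D r ->
  (forall t, D t -> `|r t| <= M) ->
  mu.-integrable D (EFin \o (fun t => W t * r t)).
Proof.
move=> mr rM.
have mW : measurable_fun D W.
  by apply/measurable_EFinP; exact: measurable_int iW.
apply: (le_integrable mD _ _ (integrableZr mD M iW)).
- by apply/measurable_EFinP; exact: measurable_funM.
- move=> t Dt; rewrite /= lee_fin !normrM ler_wpM2l//.
  by rewrite (le_trans (rM _ Dt))// ler_norm.
Qed.

Lemma integrable_Re f M : cmeasurable f -> cbounded f M ->
  mu.-integrable D (EFin \o (fun t => W t * complex.Re (f t))).
Proof.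
move=> [mf _] fM; apply: (@le_integrable_weight _ M) => // t Dt.
by rewrite (le_trans (Re_le_cmod _))// fM.
Qed.

Lemma integrable_Im f M : cmeasurable f -> cbounded f M ->
  mu.-integrable D (EFin \o (fun t => W t * complex.Im (f t))).
Proof.
move=> [_ mf] fM; apply: (@le_integrable_weight _ M) => // t Dt.
by rewrite (le_trans (Im_le_cmod _))// fM.
Qed.

Lemma cintegralD f g Mf Mg : cmeasurable f -> cmeasurable g ->
  cbounded f Mf -> cbounded g Mg ->
  cintegral (fun t => f t + g t) = cintegral f + cintegral g.
Proof.
move=> mf mg bf bg; rewrite /cintegral.
apply/eqP; rewrite eq_complex; apply/andP; split; apply/eqP => /=.
- rewrite -RintegralD//; [|exact: integrable_Re bf|exact: integrable_Re bg].
  by apply: eq_Rintegral => t _; rewrite ReD mulrDr.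
- rewrite -RintegralD//; [|exact: integrable_Im bf|exact: integrable_Im bg].
  by apply: eq_Rintegral => t _; rewrite ImD mulrDr.
Qed.

Lemma cintegralZ (c : Cfield R) f M : cmeasurable f -> cbounded f M ->
  cintegral (fun t => c * f t) = c * cintegral f.
Proof.
move=> mf bf; have iRe := integrable_Re mf bf; have iIm := integrable_Im mf bf.
case: c => a b; rewrite /cintegral.
apply/eqP; rewrite eq_complex; apply/andP; split; apply/eqP => /=.
- rewrite -!RintegralZl// -RintegralB//; last 2 first.
  + exact: (integrableZl mD a iRe).
  + exact: (integrableZl mD b iIm).
  by apply: eq_Rintegral => t _; case: (f t) => x y /=; ring.
- rewrite -!RintegralZl// -RintegralD//; last 2 first.
  + exact: (integrableZl mD a iIm).
  + exact: (integrableZl mD b iRe).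
  by apply: eq_Rintegral => t _; case: (f t) => x y /=; ring.
Qed.

Lemma eq_cintegral f g : (forall t, D t -> f t = g t) ->
  cintegral f = cintegral g.
Proof.
by move=> fg; congr (_ +i* _); apply: eq_Rintegral => t; rewrite inE => Dt;
  rewrite fg.
Qed.

Lemma cintegral_real (r : T -> R) :
  cintegral (fun t => (r t)%:C) = (\int[mu]_(t in D) (W t * r t))%:C.
Proof.
rewrite /cintegral/=; congr (_ +i* _).
by rewrite /Rintegral integral0_eq// => t _; rewrite mulr0.
Qed.

(** Bounding the real and imaginary parts separately costs a factor 2, harmless for remainders
    tending to 0. *)
Lemma cintegral_le f M : cmeasurable f -> cbounded f M ->
  cmod (cintegral f) <= (M + M) * \int[mu]_(t in D) W t.
Proof.
move=> mf bf; rewrite (le_trans (cmod_le_ReIm _))//= mulrDl lerD//.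
- have iRe := integrable_Re mf bf.
  rewrite (le_trans (le_normr_Rintegral mD iRe))//.
  rewrite -RintegralZl//; apply: le_Rintegral => //.
  + exact: integrable_norm iRe.
  + exact: (integrableZl mD M iW).
  + move=> t Dt; rewrite normrM ger0_norm ?W_ge0// mulrC.
    by rewrite ler_wpM2r ?W_ge0// (le_trans (Re_le_cmod _))// bf.
- have iIm := integrable_Im mf bf.
  rewrite (le_trans (le_normr_Rintegral mD iIm))//.
  rewrite -RintegralZl//; apply: le_Rintegral => //.
  + exact: integrable_norm iIm.
  + exact: (integrableZl mD M iW).
  + move=> t Dt; rewrite normrM ger0_norm ?W_ge0// mulrC.
    by rewrite ler_wpM2r ?W_ge0// (le_trans (Im_le_cmod _))// bf.
Qed.

End complex_integral.

Section slit_plane_distance.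
Context {R : realType}.

(** For [z] not real, [1 - z s = z (1/z - s)] and [|1/z - s|] is at least the modulus of the
    imaginary part of [1/z]. For real [z = p < 1], [1 - p s] lies between [1] and [1 - p]. The
    uniform [e] bounds the kernel and fixes the radius of expansion. *)
Lemma slit_plane_dist (z : Cfield R) : slit_plane z ->
  exists2 e : R, 0 < e &
    forall s : R, 0 <= s <= 1 -> e <= cmod (1 - z * s%:C).
Proof.
case: z => p q zslit; have [q0|q0] := eqVneq q 0.
  have p1 : p < 1.
    rewrite ltNge; apply/negP => p1; apply: zslit; exists p.
      by rewrite /= in_itv/= p1.
    by rewrite q0.
  exists (Num.min 1 (1 - p)); first by rewrite lt_min ltr01 subr_gt0.
  move=> s /andP[s0 s1]; rewrite q0.
  have -> : 1 - (p +i* 0) * s%:C = (1 - p * s)%:C :> Cfield R.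
    by rewrite rmorphB rmorphM.
  rewrite cmodR.
  rewrite (le_trans _ (ler_norm _))// ge_min.
  have [p0|p0] := leP p 0; first by rewrite lerBrDr gerDl mulr_le0_ge0.
  by apply/orP; right; rewrite lerB// -[leRHS]mulr1 ler_wpM2l// ltW.
set z : Cfield R := p +i* q.
have z0 : z != 0 by rewrite eq_complex/= negb_and q0 orbT.
exists (cmod z * `|complex.Im z^-1|).
  rewrite mulr_gt0 ?cmod_gt0// normr_gt0 /= oppr_eq0 mulf_neq0//.
  by rewrite invr_eq0 paddr_eq0 ?sqr_ge0// negb_and !sqrf_eq0 q0 orbT.
move=> s _; rewrite (_ : 1 - z * s%:C = z * (z^-1 - s%:C)); last first.
  by rewrite mulrBr divff.
rewrite cmodM ler_wpM2l ?cmod_ge0// (le_trans _ (Im_le_cmod _))//.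
by case: (z^-1) => u v /=; rewrite subr0.
Qed.

End slit_plane_distance.

(** * Analyticity of weighted integrals of [(1 - z tau)^(-N)] *)

Section continuation.
Context {R : realType} d (T : measurableType d) (mu : {measure set T -> \bar R}).
Variables (D : set T) (W tau : T -> R).
Hypothesis mD : measurable D.
Hypothesis W_ge0 : forall t, D t -> 0 <= W t.
Hypothesis iW : mu.-integrable D (EFin \o W).
Hypothesis mtau : measurable_fun D tau.
Hypothesis tau01 : forall t, D t -> 0 <= tau t <= 1.
Variable N : nat.

Local Notation C := (Cfield R).

(* The exponent is an integer, so no branch of the power has to be chosen. *)
Definition stieltjes (z : C) : C :=
  cintegral mu D W (fun t => (1 - z * (tau t)%:C) ^- N).

(** The [n]-th Taylor coefficient at [z0], obtained by differentiating formally under the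
    integral. *)
Definition stieltjes_coef (z0 : C) (n : nat) : C :=
  bincoef C N n *
  cintegral mu D W (fun t => (tau t)%:C ^+ n * (1 - z0 * (tau t)%:C) ^- (N + n)).

Lemma cmeasurable_kernel (z0 : C) n m :
  cmeasurable D (fun t => (tau t)%:C ^+ n * (1 - z0 * (tau t)%:C) ^- m).
Proof.
apply: cmeasurableM.
  by apply: cmeasurableX; exact: cmeasurable_real.
under eq_fun do rewrite -exprVn.
apply: cmeasurableX; apply: cmeasurableV; apply: cmeasurableB.
  exact: cmeasurable_cst.
by apply: cmeasurableM; [exact: cmeasurable_cst|exact: cmeasurable_real].
Qed.

Lemma cbounded_kernel (z0 : C) (e : R) n m : 0 < e ->
  (forall t, D t -> e <= cmod (1 - z0 * (tau t)%:C)) ->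
  cbounded D (fun t => (tau t)%:C ^+ n * (1 - z0 * (tau t)%:C) ^- m) (e ^- m).
Proof.
move=> e0 ez t Dt; have /andP[t0 t1] := tau01 Dt.
rewrite cmodM cmodV !cmodX cmodR ger0_norm// -[leRHS]mul1r.
rewrite ler_pM ?exprn_ge0 ?invr_ge0 ?cmod_ge0 ?exprn_ile1//.
  by rewrite exprn_ge0 ?cmod_ge0.
have cz0 : 0 < cmod (1 - z0 * (tau t)%:C) by rewrite (lt_le_trans e0)// ez.
by rewrite lef_pV2 ?posrE ?exprn_gt0// lerXn2r ?nnegrE ?ez// ltW.
Qed.

(** Since [1 - z tau = (1 - z0 tau)(1 - h)] with [|h| <= x < 1], the kernel expands in powers of
    [h]. The error of a partial sum is the integral of a [binrem], controlled uniformly by its value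
    at [x]. Keeping [e] and [x] as parameters serves both the slit plane and the whole unit disc. *)
Lemma stieltjes_expansion (z0 z : C) (e x : R) : 0 < e -> x < 1 ->
  (forall t, D t -> e <= cmod (1 - z0 * (tau t)%:C)) ->
  cmod (z - z0) <= x * e ->
  power_series (stieltjes_coef z0) (z - z0) @ \oo --> stieltjes z.
Proof.
move=> e0 x1 ez zz0.
have x0 : 0 <= x by rewrite -(pmulr_lge0 _ e0) (le_trans (cmod_ge0 _) zz0).
pose h t : C := (z - z0) * (tau t)%:C / (1 - z0 * (tau t)%:C).
have nz t : D t -> 1 - z0 * (tau t)%:C != 0.
  by move=> Dt; rewrite -cmod_gt0 (lt_le_trans e0)// ez.
have hx t : D t -> cmod (h t) <= x.
  move=> Dt; have /andP[t0 t1] := tau01 Dt.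
  rewrite /h !cmodM cmodV cmodR ger0_norm// ler_pdivrMr ?cmod_gt0 ?nz//.
  rewrite -[leRHS]mulr1 ler_pM ?cmod_ge0// (le_trans zz0)//.
  by rewrite ler_wpM2l// ez.
have zE t : D t -> 1 - z * (tau t)%:C = (1 - z0 * (tau t)%:C) * (1 - h t).
  by move=> Dt; rewrite /h mulrBr mulr1 mulrCA divff ?nz// mulr1; ring.
have mh : cmeasurable D h.
  apply: cmeasurableM.
    by apply: cmeasurableM; [exact: cmeasurable_cst|exact: cmeasurable_real].
  apply: cmeasurableV; apply: cmeasurableB; first exact: cmeasurable_cst.
  by apply: cmeasurableM; [exact: cmeasurable_cst|exact: cmeasurable_real].
have mk : cmeasurable D (fun t => (1 - z0 * (tau t)%:C) ^- N).
  have := cmeasurable_kernel z0 0 N.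
  by under eq_fun do rewrite expr0 mul1r.
have bk t : D t -> cmod ((1 - z0 * (tau t)%:C) ^- N) <= e ^- N.
  have := cbounded_kernel 0 N e0 ez.
  by move=> /[apply]; rewrite expr0 mul1r.
have msum M : cmeasurable D (fun t => binsum N M (h t)).
  elim: M => [|M IH].
    by under eq_fun do rewrite /binsum big_ord0; exact: cmeasurable_cst.
  under eq_fun do rewrite /binsum big_ord_recr/=.
  apply: cmeasurableD; first exact: IH.
  by apply: cmeasurableM; [exact: cmeasurable_cst|exact: cmeasurableX].
have bsum M : cbounded D (fun t => (1 - z0 * (tau t)%:C) ^- N * binsum N M (h t))
    (e ^- N * binsum N M x).
  move=> t Dt; rewrite cmodM ler_pM ?cmod_ge0 ?bk//.
  rewrite (le_trans (cmod_sum _ _ _))// ler_sum// => i _.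
  rewrite cmodM -(bincoef_rmorph (real_complex R : {rmorphism R -> C})).
  rewrite cmodR ger0_norm ?bincoef_ge0// ler_wpM2l ?bincoef_ge0// cmodX.
  by rewrite lerXn2r ?nnegrE ?cmod_ge0 ?hx.
have msum' M : cmeasurable D
    (fun t => (1 - z0 * (tau t)%:C) ^- N * binsum N M (h t)).
  exact: cmeasurableM.
have partialE M : power_series (stieltjes_coef z0) (z - z0) M =
    cintegral mu D W (fun t => (1 - z0 * (tau t)%:C) ^- N * binsum N M (h t)).
  elim: M => [|M IH].
    rewrite /power_series /series/= big_nil.
    rewrite (@eq_cintegral _ _ _ mu D W _ (fun t => 0%:C)).
      by rewrite cintegral_real; under eq_Rintegral do rewrite mulr0;
        rewrite Rintegral_cst// mul0r.
    by move=> t _; rewrite /binsum big_ord0 mulr0.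
  rewrite /power_series seriesSr -/(power_series _ _) IH.
  rewrite [RHS](@eq_cintegral _ _ _ mu D W _ (fun t =>
      (1 - z0 * (tau t)%:C) ^- N * binsum N M (h t) +
      (bincoef C N M * (z - z0) ^+ M) *
        ((tau t)%:C ^+ M * (1 - z0 * (tau t)%:C) ^- (N + M)))); last first.
    move=> t Dt; rewrite /binsum big_ord_recr/= mulrDr; congr (_ + _).
    rewrite /h !exprMn exprVn exprD invfM; ring.
  have bM := cbounded_kernel M (N + M) e0 ez.
  have mM := cmeasurable_kernel z0 M (N + M).
  rewrite (cintegralD mD iW (msum' M) _ (bsum M)
    (Mg := cmod (bincoef C N M * (z - z0) ^+ M) * e ^- (N + M))).
  - rewrite (cintegralZ mD iW _ mM bM) /stieltjes_coef; congr (_ + _).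
    by rewrite mulrAC.
  - by apply: cmeasurableM => //; exact: cmeasurable_cst.
  - by move=> t Dt; rewrite cmodM ler_wpM2l ?cmod_ge0// bM.
have mrem M : cmeasurable D
   (fun t => (1 - z0 * (tau t)%:C) ^- N * binrem N M (h t)).
  apply: (cmeasurableM mk); apply: cmeasurableB; last exact: msum.
  under eq_fun do rewrite -exprVn.
  apply: cmeasurableX; apply: cmeasurableV; apply: cmeasurableB => //.
have brem M : cbounded D
   (fun t => (1 - z0 * (tau t)%:C) ^- N * binrem N M.+1 (h t))
   (e ^- N * binrem N M.+1 x).
  by move=> t Dt; rewrite cmodM ler_pM ?cmod_ge0 ?bk// cmod_binrem ?hx.
have remE M : stieltjes z - power_series (stieltjes_coef z0) (z - z0) M.+1 =
    cintegral mu D W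
      (fun t => (1 - z0 * (tau t)%:C) ^- N * binrem N M.+1 (h t)).
  rewrite partialE; apply/eqP; rewrite subr_eq addrC; apply/eqP.
  rewrite -(cintegralD mD iW (msum' _) (mrem _) (bsum _) (brem _)).
  apply: eq_cintegral => t Dt; rewrite -mulrDr /binrem [binsum _ _ _ + _]addrC subrK zE//.
  by rewrite exprMn invfM.
pose K := 2 * e ^- N * \int[mu]_(t in D) W t.
have rem0 : (fun M => K * binrem N M x) @ \oo --> (0 : R).
  rewrite -[X in _ --> X](mulr0 K); apply: cvgMl_tmp.
  by apply: binrem_cvg0; rewrite x0.
apply/cvgCP => eps eps0.
move/(@cvgrPdist_lt _ R^o) : rem0 => /(_ _ eps0) [M0 _ hM0].
exists M0.+1 => // -[//|M] /= MM0.
have := hM0 M.+1 (leqW MM0); rewrite sub0r normrN; apply: le_lt_trans.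
rewrite remE (le_trans _ (ler_norm _))//.
rewrite (le_trans (cintegral_le mD W_ge0 iW (mrem _) (brem _)))// /K.
by rewrite le_eqVlt; apply/orP; left; apply/eqP; ring.
Qed.

Lemma stieltjes_analytic (z0 : C) : slit_plane z0 -> analytic_at stieltjes z0.
Proof.
move=> /slit_plane_dist[e e0 ez].
(* Half the distance gives the ratio [x = 1/2]. *)
exists (stieltjes_coef z0), (2^-1 * e); split; first by rewrite mulr_gt0.
move=> z; rewrite normCE ltcR => /ltW zz0.
apply: (stieltjes_expansion e0 _ _ zz0); first by rewrite invf_lt1 ?ltr1n.
by move=> t Dt; apply: ez; exact: tau01.
Qed.

Lemma stieltjes_unit_disc (z : C) : unit_disc z ->
  power_series (stieltjes_coef 0) z @ \oo --> stieltjes z.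
Proof.
rewrite /unit_disc/= normCE -[1]/(1%:C) ltcR => z1.
rewrite -[X in power_series _ X]subr0.
apply: (stieltjes_expansion ltr01 z1); last by rewrite subr0 mulr1.
by move=> t Dt; rewrite mul0r subr0 cmod1.
Qed.

(** At [z0 = 0] the Taylor coefficients are [bincoef] times the moments of [tau], so matching
    moments is all that is required. *)
Lemma stieltjes_continues2F1 (a b c : C) :
  (forall n, coef2F1 a b c n =
     bincoef C N n * (\int[mu]_(t in D) (W t * tau t ^+ n))%:C) ->
  continues2F1 a b c stieltjes.
Proof.
move=> h; split; first exact: stieltjes_analytic.
move=> z z1; rewrite (_ : coef2F1 a b c = stieltjes_coef 0).
  exact: stieltjes_unit_disc.
apply/funext => n; rewrite h /stieltjes_coef; congr (_ * _).
rewrite -cintegral_real; apply: eq_cintegral => t _.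
by rewrite mul0r subr0 expr1n invr1 mulr1 rmorphXn.
Qed.

End continuation.

(** * Independence of the value at -1 from the chosen continuation *)

Section analytic_continuity.
Context {R : realType}.
Local Notation C := (Cfield R).

Lemma power_series_term_bounded (u : nat -> C) (z l : C) :
  power_series u z @ \oo --> l ->
  exists2 M : R, 0 <= M & forall n, cmod (u n * z ^+ n) <= M.
Proof.
move=> /cvgCP/(_ 1 ltr01)[N _ hN].
(* From [N] on, a term is a difference of two errors of partial sums, each below 1; the sum covers
   the earlier terms. *)
exists (2 + \sum_(n < N) cmod (u n * z ^+ n)).
  by rewrite addr_ge0// sumr_ge0// => i _; exact: cmod_ge0.
move=> n; have [nN|Nn] := ltnP n N.
  rewrite (bigD1 (Ordinal nN))//= addrCA lerDl addr_ge0//.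
  by rewrite sumr_ge0// => i _; exact: cmod_ge0.
rewrite -[leLHS]addr0 lerD//; last first.
  by rewrite sumr_ge0// => i _; exact: cmod_ge0.
have -> : u n * z ^+ n =
    (l - power_series u z n) - (l - power_series u z n.+1).
  by rewrite /power_series seriesSr; ring.
rewrite (le_trans (cmodD _ _))// cmodN -[2]/(1 + 1) lerD// ltW//.
  exact: hN.
by apply: hN; exact: leqW.
Qed.

Lemma geometric_tail_le (x : R) M : 0 <= x <= 2^-1 ->
  \sum_(n < M) x ^+ n.+1 <= 2 * x.
Proof.
move=> /andP[x0 x1].
have h : (1 - x) * \sum_(n < M) x ^+ n.+1 = x - x ^+ M.+1.
  elim: M => [|M IH]; first by rewrite big_ord0; ring.
  by rewrite big_ord_recr/= mulrDr IH !exprS; ring.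
have S0 : 0 <= \sum_(n < M) x ^+ n.+1.
  by rewrite sumr_ge0// => i _; rewrite exprn_ge0.
have xM : 0 <= x ^+ M.+1 by rewrite exprn_ge0.
move: h; set S := \sum_(n < M) _ in S0 *; set y := x ^+ M.+1 in xM *.
nra.
Qed.

Lemma analytic_at_continuous (F : C -> C) (z0 : C) : analytic_at F z0 ->
  forall eps : R, 0 < eps -> exists2 e : R, 0 < e &
    forall z, cmod (z - z0) < e -> cmod (F z - F z0) <= eps.
Proof.
move=> [u [r [r0 hF]]] eps eps0.
pose p := r / 2.
have p0 : 0 < p by rewrite divr_gt0.
have pr : p < r by rewrite /p; lra.
have Fz0 : F z0 = u 0%N.
  have := hF z0; rewrite subrr normr0 ltcR => /(_ r0) /cvgC_eq; apply.
  rewrite -cvg_shiftS; apply: cvg_near_cst; apply: nearW => n.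
  rewrite /power_series /series/= big_nat_recl// expr0 mulr1 big1 ?addr0//.
  by move=> i _; rewrite expr0n mulr0.
have [M M0 hM] : exists2 M : R, 0 <= M & forall n, cmod (u n) * p ^+ n <= M.
  have := hF (z0 + p%:C); rewrite addrAC subrr add0r normCE cmodR ltcR.
  rewrite gtr0_norm// => /(_ pr)/power_series_term_bounded[M M0 hM].
  exists M => // n; have := hM n.
  by rewrite cmodM cmodX cmodR gtr0_norm.
(* With [x = |z - z0| / p], the first bound gives [x <= 1/2], so the tail is at most [2 M x]; the
   second makes this at most [eps]. The [+ 1] avoids division by zero. *)
exists (Num.min (p / 2) (p * eps / (2 * M + 1))).
  by rewrite lt_min divr_gt0//= divr_gt0 ?mulr_gt0// ltr_wpDl// mulr_ge0.
move=> z; rewrite lt_min => /andP[zp ze].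
have /hF cz : `|z - z0| < r%:C.
  by rewrite normCE ltcR (lt_trans zp)//; rewrite /p; lra.
rewrite Fz0 cmodB; apply: (cvg_cmod_le cz).
exists 1%N => // -[//|K] _ /=.
pose x := cmod (z - z0) / p.
have x0 : 0 <= x by rewrite divr_ge0 ?cmod_ge0 ?ltW.
have x1 : x <= 2^-1 by rewrite ler_pdivrMr// mulrC ltW.
have xe : 2 * M * x <= eps.
  have : cmod (z - z0) * (2 * M + 1) <= p * eps.
    by rewrite -ler_pdivlMr ?ltW// ltr_wpDl// mulr_ge0.
  have -> : cmod (z - z0) = x * p by rewrite divfK// gt_eqF.
  have : 0 <= x * p by rewrite mulr_ge0// ltW.
  move=> h1 h2; rewrite -(ler_pM2l p0); nra.
apply: le_trans xe; rewrite cmodB.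
rewrite /power_series /series/= big_nat_recl// expr0 mulr1 addrAC subrr add0r.
rewrite big_mkord (le_trans (cmod_sum _ _ _))//.
apply: (@le_trans _ _ (M * \sum_(i < K) x ^+ i.+1)).
  rewrite mulr_sumr ler_sum// => i _.
  rewrite cmodM cmodX (_ : cmod (z - z0) = p * x); last first.
    by rewrite mulrC divfK// gt_eqF.
  by rewrite exprMn mulrA ler_wpM2r ?exprn_ge0.
rewrite (_ : 2 * M * x = M * (2 * x)); last by ring.
by rewrite ler_wpM2l// geometric_tail_le// x0.
Qed.

Lemma slit_planeN1 : slit_plane (-1 : C).
Proof.
move=> [x]; rewrite /= in_itv/= andbT => x1 [xE _].
by move: x1; rewrite xE; apply/negP; rewrite -ltNge; lra.
Qed.

Lemma continues2F1_N1 (a b c : C) (F G : C -> C) :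
  continues2F1 a b c F -> continues2F1 a b c G -> F (-1) = G (-1).
Proof.
move=> [aF dF] [aG dG].
apply/eqP; rewrite -subr_eq0 -cmod_eq0 eq_le cmod_ge0 andbT.
apply/ler_addgt0Pr => eps eps0; rewrite add0r.
have e20 : 0 < eps / 2 by rewrite divr_gt0.
have [e1 e10 h1] := analytic_at_continuous (aF _ slit_planeN1) e20.
have [e2 e20' h2] := analytic_at_continuous (aG _ slit_planeN1) e20.
(* The point [-1 + e] lies in the unit disc, where both functions sum the same series, and is close
   enough to -1 for both continuity bounds. *)
pose e := Num.min 1 (Num.min e1 e2) / 2.
have m0 : 0 < Num.min 1 (Num.min e1 e2) by rewrite !lt_min ltr01 e10.
have e0 : 0 < e by rewrite divr_gt0.
have em : e < Num.min 1 (Num.min e1 e2) by rewrite /e; lra.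
move: em; rewrite !lt_min => /and3P[eL1 eLe1 eLe2].
pose z : C := -1 + e%:C.
have zE : cmod (z - -1) = e.
  by rewrite /z addrAC subrr add0r cmodR gtr0_norm.
have zd : unit_disc z.
  rewrite /unit_disc/= (_ : z = (-1 + e)%:C); last by rewrite rmorphD rmorphN.
  by rewrite normCE cmodR -[X in _ < X]/(1%:C) ltcR ltr_norml; apply/andP; split; lra.
have FG : F z = G z by exact: cvgC_eq (dF _ zd) (dG _ zd).
have -> : F (-1) - G (-1) = (G z - G (-1)) - (F z - F (-1)) by rewrite FG; ring.
rewrite (le_trans (cmodD _ _))// cmodN (splitr eps) lerD//.
- by apply: h2; rewrite zE.
- by apply: h1; rewrite zE.
Qed.

Lemma hyp2F1_N1 (a b c : C) (F : C -> C) :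
  continues2F1 a b c F -> hyp2F1 a b c (-1) = F (-1).
Proof.
move=> cF; apply: (continues2F1_N1 _ cF).
apply: (@xgetPex _ (fun=> 0) [set F0 | continues2F1 a b c F0]).
by exists F; exact: cF.
Qed.

End analytic_continuity.

(** * Moments of a product of two beta laws *)

Section beta_product.
Context {R : realType}.
Local Notation mu := (@lebesgue_measure R).
Local Notation halfline := (`]0%R, +oo[%classic : set R).
Local Notation quadrant := (halfline `*` halfline).
Local Notation C := (Cfield R).

Lemma tonelli_quadrant (f : R * R -> \bar R) :
  measurable_fun setT f -> (forall z, (0 <= f z)%E) ->
  (\int[(mu \x mu)%E]_(z in quadrant) f z =
   \int[mu]_(y in halfline) \int[mu]_(x in halfline) f (x, y))%E.
Proof.
move=> mf f0.
pose g := f \_ quadrant.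
have mg : measurable_fun setT g.
  apply/(measurable_restrictT _ _).1 => //; first exact: measurableX.
  exact: measurable_funS mf.
have g0 z : (0 <= g z)%E by rewrite /g patchE; case: ifP.
rewrite integral_mkcond [LHS](fubini_tonelli2 (m1 := mu) (m2 := mu) g mg g0).
rewrite [RHS]integral_mkcond; apply: eq_integral => y _.
rewrite /fubini_G patchE; case: ifPn => yD.
  rewrite [RHS]integral_mkcond; apply: eq_integral => x _.
  by rewrite /g !patchE in_setX yD andbT.
by apply: integral0_eq => x _; rewrite /g patchE in_setX (negbTE yD) andbF.
Qed.

Lemma integral_quadrant_prod (f g : R -> R) :
  measurable_fun setT f -> measurable_fun setT g ->
  (forall r, 0 <= f r) -> (forall r, 0 <= g r) ->
  (\int[(mu \x mu)%E]_(z in quadrant) (f z.1 * g z.2)%:E =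
   \int[mu]_(r in halfline) (f r)%:E * \int[mu]_(r in halfline) (g r)%:E)%E.
Proof.
move=> mf mg f0 g0; rewrite tonelli_quadrant; last 2 first.
- apply/measurable_EFinP; apply: measurable_funM.
  + exact: (measurableT_comp mf measurable_fst).
  + exact: (measurableT_comp mg measurable_snd).
- by move=> z; rewrite lee_fin mulr_ge0.
rewrite -ge0_integralZl//; last 3 first.
- by apply/measurable_EFinP/measurable_funTS.
- by move=> r _; rewrite lee_fin.
- by apply: integral_ge0 => r _; rewrite lee_fin.
apply: eq_integral => r2 _ /=.
rewrite -ge0_integralZr//; last 3 first.
- by apply/measurable_EFinP/measurable_funTS.
- by move=> r _; rewrite lee_fin.
- by rewrite lee_fin.
Qed.

Definition beta (a b : R) : R := Gamma a * Gamma b / Gamma (a + b).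

Lemma beta_gt0 a b : 0 < a -> 0 < b -> 0 < beta a b.
Proof.
by move=> a0 b0; rewrite divr_gt0 ?mulr_gt0 ?Gamma_gt0 ?addr_gt0.
Qed.

Lemma Gamma_pochhammer (a : R) n : 0 < a ->
  Gamma (a + n%:R) = pochhammer a n * Gamma a.
Proof.
move=> a0; elim: n => [|n IH]; first by rewrite addr0 pochhammer0 mul1r.
have an : 0 < a + n%:R by rewrite ltr_wpDr.
rewrite -natr1 addrA (GammaS an) IH pochhammerS.
by move: (Gamma a) => g; ring.
Qed.

Lemma beta_shift (a b : R) n : 0 < a -> 0 < b ->
  beta (a + n%:R) b = pochhammer a n / pochhammer (a + b) n * beta a b.
Proof.
move=> a0 b0; rewrite /beta addrAC !Gamma_pochhammer ?addr_gt0//.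
rewrite invfM; move: (Gamma a) (Gamma b) (Gamma _)^-1 => *; ring.
Qed.

(** The beta density [t^(a-1) (1-t)^(p-a-1)], unnormalized, after [t = r / (1 + r)], Jacobian
    included. *)
Definition beta_weight (a p r : R) : R := r `^ (a - 1) * (1 + r) `^ (- p).

Lemma measurable_1D_powR (k p : R) : measurable_fun setT (fun r : R => (1 + k * r) `^ p).
Proof.
apply: measurable_powR_comp; apply: measurable_funD => //.
Qed.

Lemma measurable_beta_weight a p : measurable_fun setT (beta_weight a p).
Proof.
apply: measurable_funM; first exact: measurable_powR.
by have := measurable_1D_powR 1 (- p); under eq_fun do rewrite mul1r.
Qed.

Lemma beta_weight_ge0 a p r : 0 <= beta_weight a p r.
Proof. by rewrite mulr_ge0 ?powR_ge0. Qed.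

Lemma integral_beta_weight (a p : R) : 0 < a -> a < p ->
  (\int[mu]_(r in halfline) (beta_weight a p r)%:E = (beta a (p - a))%:E)%E.
Proof.
move=> a0 ap; have pa : 0 < p - a by rewrite subr_gt0.
have := @Gamma_beta R a (p - a) 1 a0 pa ltr01.
rewrite powR1 mul1r -/(beta _ _) => <-.
by apply: eq_integral => r _; rewrite /beta_weight mul1r [a + (p - a)]addrC subrK.
Qed.

(** Multiplication by [t^n] raises both parameters by [n], so a moment is again a beta integral. *)
Lemma beta_weight_ratio a p r n : 0 < r ->
  beta_weight a p r * (r / (1 + r)) ^+ n = beta_weight (a + n%:R) (p + n%:R) r.
Proof.
move=> r0; have r1 : 0 < 1 + r by rewrite addr_gt0.
rewrite /beta_weight expr_div_n -!powR_mulrn ?ltW// -powRN.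
rewrite addrAC opprD -!powR_gt0_add//; ring.
Qed.

Variables (x y w : R) (N : nat).
Hypotheses (x_gt0 : 0 < x) (y_gt0 : 0 < y) (yw : y < w) (xN : x < N%:R).

Let xN0 : 0 < N%:R - x. Proof. by rewrite subr_gt0. Qed.
Let yw0 : 0 < w - y. Proof. by rewrite subr_gt0. Qed.

Let kappa : R := (beta x (N%:R - x) * beta y (w - y))^-1.

Let kappa_ge0 : 0 <= kappa.
Proof. by rewrite invr_ge0 mulr_ge0// ltW// beta_gt0. Qed.

(* Normalized product of two beta densities in the variables [t = r / (1 + r)];
   the moments of [t1 t2] are [(x)_n (y)_n / ((N)_n (w)_n)]. *)
Definition beta2_weight (z : R * R) : R :=
  kappa * (beta_weight x N%:R z.1 * beta_weight y w z.2).

(* [powR] rather than division, since measurability lemmas exist for [powR]. *)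
Definition beta2_tau (z : R * R) : R :=
  (z.1 * (1 + z.1) `^ (-1)) * (z.2 * (1 + z.2) `^ (-1)).

Lemma beta2_tauE z : quadrant z ->
  beta2_tau z = z.1 / (1 + z.1) * (z.2 / (1 + z.2)).
Proof.
case: z => r1 r2 []; rewrite !mem_halfline/= => r10 r20.
by rewrite /beta2_tau/= !powR_inv1// addr_ge0// ltW.
Qed.

Lemma ratio01 (r : R) : 0 < r -> 0 <= r / (1 + r) <= 1.
Proof.
move=> r0; have r1 : 0 < 1 + r by rewrite addr_gt0.
by rewrite divr_ge0 ?(ltW r0) ?(ltW r1)//= ler_pdivrMr// mul1r lerDr.
Qed.

Lemma beta2_tau01 z : quadrant z -> 0 <= beta2_tau z <= 1.
Proof.
move=> zD; rewrite beta2_tauE//; case: z zD => r1 r2 [].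
rewrite !mem_halfline/= => /ratio01/andP[? ?] /ratio01/andP[? ?].
by rewrite mulr_ge0//= mulr_ile1.
Qed.

Lemma measurable_beta2_tau : measurable_fun setT beta2_tau.
Proof.
have h : measurable_fun setT (fun r : R => r * (1 + r) `^ (-1)).
  apply: measurable_funM; first exact: measurable_id.
  by have := measurable_1D_powR 1 (-1); under eq_fun do rewrite mul1r.
apply: measurable_funM.
- exact: (measurableT_comp h measurable_fst).
- exact: (measurableT_comp h measurable_snd).
Qed.

Lemma measurable_beta2_weight : measurable_fun setT beta2_weight.
Proof.
apply: measurable_funM; first exact: measurable_cst.
apply: measurable_funM.
- exact: (measurableT_comp (measurable_beta_weight _ _) measurable_fst).
- exact: (measurableT_comp (measurable_beta_weight _ _) measurable_snd).
Qed.

Lemma beta2_weight_ge0 z : 0 <= beta2_weight z.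
Proof.
apply: mulr_ge0; first exact: kappa_ge0.
by apply: mulr_ge0; exact: beta_weight_ge0.
Qed.

Lemma integral_beta2_tau n :
  (\int[(mu \x mu)%E]_(z in quadrant) (beta2_weight z * beta2_tau z ^+ n)%:E =
   (pochhammer x n / pochhammer N%:R n * (pochhammer y n / pochhammer w n))%:E)%E.
Proof.
have n0 : 0 <= n%:R :> R by rewrite ler0n.
transitivity (\int[(mu \x mu)%E]_(z in quadrant)
    ((kappa * beta_weight (x + n%:R) (N%:R + n%:R) z.1) *
              beta_weight (y + n%:R) (w + n%:R) z.2)%:E)%E.
  apply: eq_integral => z; rewrite inE => zD; rewrite beta2_tauE//.
  case: z zD => r1 r2 []; rewrite !mem_halfline/= => r10 r20.
  rewrite -!beta_weight_ratio// /beta2_weight/= exprMn; congr EFin; ring.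
rewrite (@integral_quadrant_prod
  (fun r => kappa * beta_weight (x + n%:R) (N%:R + n%:R) r)
  (beta_weight (y + n%:R) (w + n%:R))).
- under eq_integral do rewrite EFinM.
  rewrite ge0_integralZl_EFin ?kappa_ge0//; last 2 first.
  + by move=> r _; rewrite lee_fin beta_weight_ge0.
  + by apply/measurable_EFinP/measurable_funTS; exact: measurable_beta_weight.
  rewrite !integral_beta_weight ?ltrD2r ?ltr_wpDr// -!EFinM; congr EFin.
  rewrite (_ : N%:R + n%:R - (x + n%:R) = N%:R - x); last by ring.
  rewrite (_ : w + n%:R - (y + n%:R) = w - y); last by ring.
  rewrite !beta_shift// (_ : x + (N%:R - x) = N%:R); last by ring.
  rewrite (_ : y + (w - y) = w); last by ring.
  have /lt0r_neq0 := beta_gt0 x_gt0 xN0; have /lt0r_neq0 := beta_gt0 y_gt0 yw0.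
  rewrite /kappa; move: (beta x _) (beta y _) (pochhammer x n / _)
    (pochhammer y n / _) => ? ? ? ? ? ?.
  by field; apply/andP; split.
- by apply: measurable_funM; [exact: measurable_cst|exact: measurable_beta_weight].
- exact: measurable_beta_weight.
- by move=> r; rewrite mulr_ge0 ?kappa_ge0 ?beta_weight_ge0.
- by move=> r; rewrite beta_weight_ge0.
Qed.

Lemma integrable_beta2_weight :
  (mu \x mu)%E.-integrable quadrant (EFin \o beta2_weight).
Proof.
apply/integrableP; split.
  by apply/measurable_EFinP/measurable_funTS; exact: measurable_beta2_weight.
have := integral_beta2_tau 0.
rewrite !pochhammer0 !divr1 mulr1 => h.
apply: (@le_lt_trans _ _ 1%:E); last exact: ltry.
rewrite -h le_eqVlt; apply/orP; left; apply/eqP; apply: eq_integral => z _.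
by rewrite /= expr0 mulr1 ger0_norm ?beta2_weight_ge0.
Qed.

Definition continuation2F1 : C -> C :=
  stieltjes (mu \x mu)%E quadrant beta2_weight beta2_tau N.

(** The factor [(N)_n] of [bincoef] cancels the one in the denominator of the moments, leaving the
    coefficient of 2F1. *)
Lemma continuation2F1P : continues2F1 x%:C y%:C w%:C continuation2F1.
Proof.
apply: stieltjes_continues2F1.
- exact: measurableX.
- by move=> z _; exact: beta2_weight_ge0.
- exact: integrable_beta2_weight.
- by apply: measurable_funTS; exact: measurable_beta2_tau.
- exact: beta2_tau01.
move=> n; rewrite /Rintegral integral_beta2_tau /=.
rewrite -(bincoef_rmorph (real_complex R : {rmorphism R -> C})) -rmorphM/=.
rewrite /coef2F1 -[1]/(1%:C).
rewrite -!(pochhammer_rmorph (real_complex R : {rmorphism R -> C})).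
rewrite -!rmorphM/= -fmorphV/= -rmorphM/= /bincoef; congr (_%:C).
have N0 : 0 < N%:R :> R by rewrite (lt_trans x_gt0).
have w0 : 0 < w by rewrite (lt_trans y_gt0).
have := pochhammer_gt0 n N0; have := pochhammer_gt0 n w0.
have := @pochhammer_gt0 R 1 n ltr01.
by move=> /lt0r_neq0 ? /lt0r_neq0 ? /lt0r_neq0 ?; field; apply/and3P; split.
Qed.

End beta_product.

(** * Euler integrals *)

Section value_at_minus_one.
Context {R : realType}.
Local Notation mu := (@lebesgue_measure R).
Local Notation halfline := (`]0%R, +oo[%classic : set R).
Local Notation quadrant := (halfline `*` halfline).
Local Notation C := (Cfield R).

(* Euler's integrand [t^(y-1) (1-t)^(w-y-1) (1+t)^(-x)] at [t = r / (1 + r)]. *)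
Definition euler_integrand (x y w r : R) : R :=
  r `^ (y - 1) * ((1 + r) `^ (x - w) * (1 + 2 * r) `^ (- x)).

Definition euler_integral (x y w : R) : \bar R :=
  (\int[mu]_(r in halfline) (euler_integrand x y w r)%:E)%E.

Lemma euler_integrand_ge0 x y w r : 0 <= euler_integrand x y w r.
Proof. by rewrite !mulr_ge0 ?powR_ge0. Qed.

Lemma measurable_euler_integrand x y w :
  measurable_fun setT (euler_integrand x y w).
Proof.
apply: measurable_funM; first exact: measurable_powR.
apply: measurable_funM; last exact: measurable_1D_powR.
by have := @measurable_1D_powR R 1 (x - w); under eq_fun do rewrite mul1r.
Qed.

Variables (x y w : R).
Hypotheses (x_gt0 : 0 < x) (y_gt0 : 0 < y) (yw : y < w).

Let yw0 : 0 < w - y. Proof. by rewrite subr_gt0. Qed.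

(** Because [1 + 2 r >= 1 + r] and [x > 0], the integrand is at most [beta_weight y w]. *)
Lemma euler_integral_lty : (euler_integral x y w < +oo)%E.
Proof.
apply: (@le_lt_trans _ _ (beta y (w - y))%:E); last exact: ltry.
rewrite -integral_beta_weight//; apply: ge0_le_integral => //.
- by move=> r _; rewrite lee_fin euler_integrand_ge0.
- by apply/measurable_EFinP/measurable_funTS; exact: measurable_euler_integrand.
- by apply/measurable_EFinP/measurable_funTS; exact: measurable_beta_weight.
move=> r; rewrite mem_halfline => r0; rewrite lee_fin ler_wpM2l ?powR_ge0//.
have r1 : 0 < 1 + r by rewrite addr_gt0.
have r2 : 0 < 1 + 2 * r by rewrite addr_gt0 ?mulr_gt0.
rewrite [X in _ <= _ `^ X](_ : - w = (x - w) - x); last by ring.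
rewrite -(powR_gt0_add (x - w) (- x) r1) ler_wpM2l ?powR_ge0// !powRN.
rewrite lef_pV2 ?posrE ?powR_gt0// ge0_ler_powR ?nnegrE ?(ltW x_gt0)//.
- exact: ltW.
- exact: ltW.
- by rewrite lerD2l ler_peMl ?(ltW r0)// ler1n.
Qed.

(** Integrating out the first beta variable leaves Euler's one-dimensional integral, from which the
    auxiliary [N] has disappeared. *)
Lemma integral_stieltjes_N1 (N : nat) : x < N%:R ->
  (\int[(mu \x mu)%E]_(z in quadrant)
     (beta2_weight x y w N z * (1 + beta2_tau z) ^- N)%:E =
   ((beta y (w - y))^-1)%:E * euler_integral x y w)%E.
Proof.
move=> xN; have xN0 : 0 < N%:R - x by rewrite subr_gt0.
pose f z := (beta2_weight x y w N z * (1 + beta2_tau z) `^ (- N%:R))%:E.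
transitivity (\int[(mu \x mu)%E]_(z in quadrant) f z)%E.
  apply: eq_integral => z; rewrite inE => /beta2_tau01/andP[t0 _].
  by rewrite /f powR_invn// addr_ge0.
rewrite tonelli_quadrant; last 2 first.
- apply/measurable_EFinP; apply: measurable_funM.
    exact: measurable_beta2_weight.
  apply: measurable_powR_comp; apply: measurable_funD; first exact: measurable_cst.
  exact: measurable_beta2_tau.
- by move=> z; rewrite lee_fin mulr_ge0 ?powR_ge0 ?beta2_weight_ge0.
rewrite /euler_integral -ge0_integralZl_EFin//; last 3 first.
- by move=> r _; rewrite lee_fin euler_integrand_ge0.
- by apply/measurable_EFinP/measurable_funTS; exact: measurable_euler_integrand.
- by rewrite invr_ge0 ltW// beta_gt0.
apply: eq_integral => r2; rewrite inE mem_halfline => r20.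
have r21 : 0 < 1 + r2 by rewrite addr_gt0.
have r22 : 0 < 1 + 2 * r2 by rewrite addr_gt0 ?mulr_gt0.
(* This is [1 + t2] for [t2 = r2 / (1 + r2)]. As [(1 + r1)(1 + tau) = 1 + k r1], the inner integral
   is [Gamma_beta] with parameter [k] and contributes [k^(-x)]. *)
pose k := (1 + 2 * r2) * (1 + r2) `^ (-1).
have k0 : 0 < k by rewrite mulr_gt0 ?powR_gt0.
transitivity (\int[mu]_(r in halfline)
  (((beta x (N%:R - x) * beta y (w - y))^-1 * beta_weight y w r2)%:E *
    (r `^ (x - 1) * (1 + k * r) `^ (- (x + (N%:R - x))))%:E))%E.
  apply: eq_integral => r1; rewrite inE mem_halfline => r10.
  have r11 : 0 < 1 + r1 by rewrite addr_gt0.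
  rewrite /f -EFinM; congr EFin.
  have -> : 1 + k * r1 = (1 + r1) * (1 + beta2_tau (r1, r2)).
    rewrite /beta2_tau/= /k !powR_inv1 ?ltW//.
    by field; apply/andP; split; rewrite gt_eqF.
  have t0 : 0 <= beta2_tau (r1, r2).
    by rewrite !mulr_ge0 ?powR_ge0 ?ltW.
  rewrite powRM ?(ltW r11) ?addr_ge0// (_ : x + (N%:R - x) = N%:R); last by ring.
  rewrite /beta2_weight /beta_weight/=; ring.
rewrite ge0_integralZl_EFin; last 4 first.
- exact: measurable_itv.
- by move=> r _; rewrite lee_fin mulr_ge0 ?powR_ge0.
- apply/measurable_EFinP/measurable_funTS; apply: measurable_funM.
    exact: measurable_powR.
  exact: measurable_1D_powR.
- by rewrite mulr_ge0 ?beta_weight_ge0// invr_ge0 mulr_ge0// ltW// beta_gt0.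
rewrite Gamma_beta// -!EFinM; congr EFin.
rewrite -/(beta x (N%:R - x)) /k powRM ?(ltW r22) ?powR_ge0//.
rewrite -powRrM mulN1r opprK /beta_weight /euler_integrand.
rewrite -(powR_gt0_add x (- w) r21).
have /lt0r_neq0 := beta_gt0 x_gt0 xN0; have /lt0r_neq0 := beta_gt0 y_gt0 yw0.
move: (beta x _) (beta y _) => ? ? ? ?.
by field; apply/andP; split.
Qed.

Lemma euler_integralE :
  euler_integral x y w =
  (beta y (w - y) * complex.Re (hyp2F1 (x%:C : C) y%:C w%:C (-1)))%:E.
Proof.
pose N := (Num.truncn x).+1.
have xN : x < N%:R by rewrite truncnS_gt.
rewrite (hyp2F1_N1 (continuation2F1P x_gt0 y_gt0 yw xN)).
have -> : complex.Re (continuation2F1 x y w N (-1)) =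
    \int[(mu \x mu)%E]_(z in quadrant)
      (beta2_weight x y w N z * (1 + beta2_tau z) ^- N).
  rewrite -[RHS]/(complex.Re (_%:C)) -cintegral_real; congr (complex.Re _).
  apply: eq_cintegral => z _.
  by rewrite mulN1r opprK fmorphV rmorphXn rmorphD.
rewrite /Rintegral integral_stieltjes_N1//.
have := euler_integral_lty.
have : (0 <= euler_integral x y w)%E.
  by apply: integral_ge0 => r _; rewrite lee_fin euler_integrand_ge0.
case: (euler_integral x y w) => //= r _ _; congr EFin.
by rewrite mulVKf// gt_eqF// beta_gt0.
Qed.

End value_at_minus_one.

(** * Summation of the dominating series *)

Section clausen_at_one.
Context {R : realType}.
Local Notation mu := (@lebesgue_measure R).
Local Notation halfline := (`]0%R, +oo[%classic : set R).
Local Notation C := (Cfield R).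

Lemma eseries_EFin (f : nat -> R) (l : R) :
  series f @ \oo --> l -> (\sum_(0 <= i <oo) (f i)%:E = l%:E)%E.
Proof.
move=> fl; apply/cvg_lim => //.
rewrite (_ : (fun n => (\sum_(0 <= i < n) (f i)%:E)%E) = EFin \o series f).
  exact: cvg_EFin (nearW _ _) fl.
by apply/funext => n /=; rewrite /series/= sumEFin.
Qed.

Lemma series_cvg_of_eseries (f : nat -> R) (l : R) : (forall n, 0 <= f n) ->
  (\sum_(0 <= i <oo) (f i)%:E = l%:E)%E -> series f @ \oo --> l.
Proof.
move=> f0 fl.
have : (fun n => (\sum_(0 <= i < n) (f i)%:E)%E) @ \oo --> l%:E.
  by rewrite -fl; apply: is_cvg_nneseries => n _ _; rewrite lee_fin.
rewrite (_ : (fun n => (\sum_(0 <= i < n) (f i)%:E)%E) = EFin \o series f).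
  by move/fine_cvg.
by apply/funext => n /=; rewrite /series/= sumEFin.
Qed.

Lemma series_expR (v : R) : series (fun m => v ^+ m / m`!%:R) @ \oo --> expR v.
Proof.
rewrite /expR; exact: is_cvg_series_exp_coeff.
Qed.

(** The exponent is now real, so the recursion on [N] does not apply. Instead [(a)_m Gamma a] is
    written as the integral of [s^(a+m-1) exp(-s)]; summed under the integral, the powers of [u s]
    give [exp(u s)], and rescaling [s] by [1 - u] finishes. *)
Lemma binomial_eseries (a u : R) : 0 < a -> 0 <= u < 1 ->
  (\sum_(0 <= m <oo) (pochhammer a m / pochhammer 1 m * u ^+ m)%:E =
   ((1 - u) `^ (- a))%:E)%E.
Proof.
move=> a0 /andP[u0 u1].
have G0 := Gamma_gt0 a0.
pose f (m : nat) (s : R) : R := ((Gamma a)^-1 * (u ^+ m / m`!%:R)) *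
  (s `^ (a + m%:R - 1) * expR (- s)).
have mf m : measurable_fun setT (f m).
  apply: measurable_funM; first exact: measurable_cst.
  apply: measurable_funM; first exact: measurable_powR.
  by apply: measurable_expR_comp; exact: oppr_measurable.
have f0 m s : 0 <= f m s.
  by rewrite !mulr_ge0 ?powR_ge0 ?expR_ge0 ?invr_ge0 ?exprn_ge0// ltW.
transitivity (\int[mu]_(s in halfline) \sum_(0 <= m <oo) (f m s)%:E)%E.
  rewrite integral_nneseries//; last 2 first.
  - by move=> m; apply/measurable_EFinP/measurable_funTS; exact: mf.
  - by move=> m s _; rewrite lee_fin.
  apply: eq_eseriesr => m _; rewrite /f.
  under eq_integral do rewrite EFinM.
  rewrite ge0_integralZl_EFin//; last 3 first.
  - by move=> s _; rewrite lee_fin mulr_ge0 ?powR_ge0 ?expR_ge0.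
  - apply/measurable_EFinP/measurable_funTS.
    apply: measurable_funM; first exact: measurable_powR.
    by apply: measurable_expR_comp; exact: oppr_measurable.
  - by rewrite !mulr_ge0 ?invr_ge0 ?exprn_ge0// ltW.
  rewrite -[integral _ _ _]/(egamma (a + m%:R)) egammaE ?ltr_wpDr//.
  rewrite -EFinM Gamma_pochhammer// pochhammer1; congr EFin.
  have fm : m`!%:R != 0 :> R by rewrite pnatr_eq0 -lt0n fact_gt0.
  by field; rewrite fm gt_eqF.
transitivity (\int[mu]_(s in halfline)
  (((Gamma a)^-1)%:E * (s `^ (a - 1) * expR (- ((1 - u) * s)))%:E))%E.
  apply: eq_integral => s; rewrite inE mem_halfline => s0.
  rewrite -EFinM; apply: eseries_EFin.
  rewrite mulrBl mul1r opprB expRD.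
  rewrite (_ : _ * _ = (Gamma a)^-1 * s `^ (a - 1) * expR (- s) * expR (u * s)).
    rewrite (_ : series _ = (fun n => (Gamma a)^-1 * s `^ (a - 1) * expR (- s) *
        series (fun m => (u * s) ^+ m / m`!%:R) n)).
      by apply: cvgMl_tmp; exact: series_expR.
    apply/funext => n; rewrite /series/= mulr_sumr; apply: eq_bigr => m _.
    rewrite /f addrAC -(powR_gt0_add (a - 1) m%:R s0) powR_mulrn ?ltW//.
    by rewrite exprMn; ring.
  by ring.
rewrite ge0_integralZl_EFin ?invr_ge0 ?ltW//; last 2 first.
- by move=> s _; rewrite lee_fin mulr_ge0 ?powR_ge0 ?expR_ge0.
- apply/measurable_EFinP/measurable_funTS.
  apply: measurable_funM; first exact: measurable_powR.
  apply: measurable_expR_comp; apply: measurableT_comp => //.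
rewrite integral_powR_expR ?subr_gt0// egammaE// -!EFinM; congr EFin.
by field; rewrite gt_eqF.
Qed.

(* By duplication this is the coefficient of [3F2(a, b/2, (b+1)/2; c/2, (c+1)/2)]. *)
Definition clausen_term (a b c : R) (m : nat) : R :=
  pochhammer a m / pochhammer 1 m * (pochhammer b (2 * m) / pochhammer c (2 * m)).

Lemma clausen_term_ge0 a b c m : 0 <= a -> 0 <= b -> 0 <= c ->
  0 <= clausen_term a b c m.
Proof.
by move=> a0 b0 c0; rewrite mulr_ge0// divr_ge0// pochhammer_ge0.
Qed.

(** The ratio [(b)_2m / (c)_2m] is the [2m]-th moment of a normalized beta law, so the series sums
    under the integral by [binomial_eseries]. *)
Lemma clausen_eseries (a b c : R) : 0 < a -> 0 < b -> a + b < c ->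
  (\sum_(0 <= m <oo) (clausen_term a b c m)%:E =
   ((beta b (c - b))^-1)%:E * euler_integral a b (c - a))%E.
Proof.
move=> a0 b0 abc.
have bc : b < c by rewrite (lt_trans _ abc)// ltrDr.
have cb0 : 0 < c - b by rewrite subr_gt0.
have c0 : 0 < c by rewrite (lt_trans b0).
have B0 := beta_gt0 b0 cb0.
pose k m := (beta b (c - b))^-1 * (pochhammer a m / pochhammer 1 m).
have k0 m : 0 <= k m.
  apply: mulr_ge0; first by rewrite invr_ge0 ltW.
  by rewrite divr_ge0 ?pochhammer_ge0 ?(ltW a0).
pose f m r := k m * beta_weight (b + (2 * m)%:R) (c + (2 * m)%:R) r.
have f0 m r : 0 <= f m r by rewrite mulr_ge0 ?beta_weight_ge0.
have mf m : measurable_fun setT (f m).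
  apply: measurable_funM; first exact: measurable_cst.
  exact: measurable_beta_weight.
transitivity (\int[mu]_(r in halfline) \sum_(0 <= m <oo) (f m r)%:E)%E.
  rewrite integral_nneseries//; last 2 first.
  - by move=> m; apply/measurable_EFinP/measurable_funTS; exact: mf.
  - by move=> m r _; rewrite lee_fin.
  apply: eq_eseriesr => m _; rewrite /f.
  under eq_integral do rewrite EFinM.
  rewrite ge0_integralZl_EFin//; last 2 first.
  - by move=> r _; rewrite lee_fin beta_weight_ge0.
  - by apply/measurable_EFinP/measurable_funTS; exact: measurable_beta_weight.
  rewrite integral_beta_weight ?ltrD2r ?ltr_wpDr// -EFinM; congr EFin.
  rewrite (_ : c + (2 * m)%:R - (b + (2 * m)%:R) = c - b); last by ring.
  rewrite beta_shift// (_ : b + (c - b) = c); last by ring.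
  rewrite /clausen_term /k; move: B0 => /lt0r_neq0.
  move: (pochhammer a m / _) (pochhammer b _ / _) => p q ?.
  by field.
rewrite /euler_integral -ge0_integralZl_EFin ?invr_ge0 ?(ltW B0)//; last 2 first.
- by move=> r _; rewrite lee_fin euler_integrand_ge0.
- by apply/measurable_EFinP/measurable_funTS; exact: measurable_euler_integrand.
apply: eq_integral => r; rewrite inE mem_halfline => r0.
have r1 : 0 < 1 + r by rewrite addr_gt0.
have r2 : 0 < 1 + 2 * r by rewrite addr_gt0 ?mulr_gt0.
pose u := (r / (1 + r)) ^+ 2.
(* Here [u = t^2], and [1 - t^2] is the product of [1 - t = 1 / (1 + r)] and
   [1 + t = (1 + 2 r) / (1 + r)]. *)
have uE : 1 - u = (1 + 2 * r) * (1 + r) `^ (- 2).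
  rewrite /u -[2 in RHS]/(2%:R) powR_invn ?(ltW r1)//.
  by field; rewrite gt_eqF.
have u01 : 0 <= u < 1.
  rewrite sqr_ge0/= -subr_gt0 uE mulr_gt0// powR_gt0//.
have -> : euler_integrand a b (c - a) r =
    beta_weight b c r * (1 - u) `^ (- a).
  rewrite uE powRM ?(ltW r2) ?powR_ge0// -powRrM /euler_integrand /beta_weight.
  rewrite (_ : a - (c - a) = - c + (- 2 * - a)); last by ring.
  by rewrite -(powR_gt0_add (- c) _ r1); ring.
transitivity (((beta b (c - b))^-1 * beta_weight b c r)%:E *
    ((1 - u) `^ (- a))%:E)%E; last first.
  by rewrite -[LHS]EFinM -[RHS]EFinM -[in LHS]mulrA.
rewrite -(binomial_eseries a0 u01) -nneseriesZl; last first.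
  move=> m _; rewrite lee_fin mulr_ge0 ?divr_ge0 ?pochhammer_ge0 ?(ltW a0)//.
  by rewrite exprn_ge0// sqr_ge0.
apply: eq_eseriesr => m _; rewrite -EFinM; congr EFin.
rewrite /f -beta_weight_ratio// /k /u -exprM; ring.
Qed.

Lemma clausen_series (a b c : R) : 0 < a -> 0 < b -> a + b < c ->
  series (clausen_term a b c) @ \oo -->
  Gamma c * Gamma (c - a - b) / (Gamma (c - a) * Gamma (c - b)) *
  complex.Re (hyp2F1 (a%:C : C) b%:C (c - a)%:C (-1)).
Proof.
move=> a0 b0 abc.
have bca : b < c - a by lra.
have cb0 : 0 < c - b by lra.
have ca0 : 0 < c - a by lra.
have cab0 : 0 < c - a - b by lra.
have c0 : 0 < c by lra.
apply: series_cvg_of_eseries.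
  by move=> m; apply: clausen_term_ge0; apply: ltW.
rewrite clausen_eseries// euler_integralE// -EFinM; congr EFin.
rewrite /beta (_ : b + (c - b) = c); last by ring.
rewrite (_ : b + (c - a - b) = c - a); last by ring.
have /lt0r_neq0 := Gamma_gt0 b0; have /lt0r_neq0 := Gamma_gt0 cb0.
have /lt0r_neq0 := Gamma_gt0 ca0; have /lt0r_neq0 := Gamma_gt0 c0.
move: (Gamma b) (Gamma (c - b)) (Gamma (c - a)) (Gamma c) (Gamma _)
  (complex.Re _) => *.
by field; apply/and4P; split.
Qed.

End clausen_at_one.

(** * The class of convex functions *)

Section power_series_derivative.
Context {R : realType}.
Local Notation C := (Cfield R).

Lemma unit_discE (z : C) : unit_disc z = (cmod z < 1) :> Prop.
Proof. by rewrite /unit_disc/= normCE -[X in _ < X]/(1%:C) ltcR. Qed.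

Lemma bounded_power_series_cvg (u : nat -> C) (M : R) (z : C) :
  (forall n, cmod (u n) <= M) -> unit_disc z ->
  exists l : C, power_series u z @ \oo --> l.
Proof.
move=> uM; rewrite unit_discE => z1; apply: abs_cvg_series.
apply: (@series_le_cvg _ _ (fun n => M * cmod z ^+ n)).
- by move=> n; exact: cmod_ge0.
- move=> n; rewrite mulr_ge0 ?exprn_ge0 ?cmod_ge0//.
  exact: le_trans (cmod_ge0 _) (uM n).
- by move=> n; rewrite cmodM cmodX ler_wpM2r ?exprn_ge0 ?cmod_ge0.
- by apply: is_cvg_geometric_series; rewrite ger0_norm ?cmod_ge0.
Qed.

Lemma power_series_shift (v : nat -> C) (z l : C) :
  power_series v z @ \oo --> l ->
  power_series (fun n => if n is m.+1 then v m else 0) z @ \oo --> z * l.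
Proof.
move=> vl; rewrite -cvg_shiftS.
rewrite (_ : (fun n => _) = (fun n => z * power_series v z n)).
  by apply: cvgMl_tmp.
apply/funext => n; rewrite /power_series /series/= big_nat_recl// mul0r add0r.
by rewrite mulr_sumr; apply: eq_bigr => i _; rewrite exprS mulrCA.
Qed.

Lemma bincoef2E (K : numFieldType) n : bincoef K 2 n = n.+1%:R.
Proof.
have h1 m : bincoef K 1 m = 1 by rewrite /bincoef divff// pochhammer1_neq0.
elim: n => [|n IH]; first by rewrite bincoefN0.
by rewrite bincoefSS h1 IH nat1r.
Qed.

Lemma cmod_nat n : cmod (n%:R : C) = n%:R.
Proof.
by rewrite -(rmorph_nat (real_complex R : {rmorphism R -> C})) cmodR ger0_norm.
Qed.

(** The remainder for the next exponent is [z + h] times the present one plus [(n+2) z^(n+1) h^2].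
    The bounds then obey Pascal's rule for [bincoef R 3], since [bincoef R 2 (n+1) = n + 2]. *)
Lemma exprD_taylor2 (z h : C) (p : R) n :
  cmod z <= p -> cmod (z + h) <= p ->
  cmod ((z + h) ^+ n.+2 - z ^+ n.+2 - n.+2%:R * z ^+ n.+1 * h) <=
    bincoef R 3 n * p ^+ n * cmod h ^+ 2.
Proof.
move=> zp zhp.
have p0 : 0 <= p := le_trans (cmod_ge0 z) zp.
elim: n => [|n IH].
  rewrite bincoefN0 expr0 !mul1r -cmodX.
  by rewrite (_ : _ - _ = h ^+ 2)//; ring.
rewrite (_ : _ - _ = (z + h) *
   ((z + h) ^+ n.+2 - z ^+ n.+2 - n.+2%:R * z ^+ n.+1 * h) +
   n.+2%:R * z ^+ n.+1 * h ^+ 2); last first.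
  by rewrite !exprS -[n.+3%:R]natr1; ring.
rewrite (le_trans (cmodD _ _))//.
rewrite [leRHS](_ : _ = p * (bincoef R 3 n * p ^+ n * cmod h ^+ 2) +
    n.+2%:R * p ^+ n.+1 * cmod h ^+ 2); last first.
  by rewrite bincoefSS bincoef2E exprS; ring.
rewrite lerD//; first by rewrite cmodM ler_pM ?cmod_ge0.
rewrite !cmodM !cmodX ler_wpM2r ?mulr_ge0 ?cmod_ge0//.
rewrite cmod_nat.
by rewrite ler_wpM2l// lerXn2r ?nnegrE ?cmod_ge0.
Qed.

(** Summing [exprD_taylor2] bounds the first-order Taylor error by [M (1 - p)^(-3) |h|^2], which
    gives the derivative directly. *)
Lemma derive1_power_series (u : nat -> C) (M : R) (F D : C -> C) :
  (forall n, cmod (u n) <= M) ->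
  (forall z, unit_disc z -> power_series u z @ \oo --> F z) ->
  (forall z, unit_disc z ->
     power_series (fun n => n.+1%:R * u n.+1) z @ \oo --> D z) ->
  forall z, unit_disc z -> derive1 F z = D z.
Proof.
move=> uM uF uD z zd.
have M0 : 0 <= M := le_trans (cmod_ge0 _) (uM 0%N).
have z1 : cmod z < 1 by rewrite -unit_discE.
pose p := (1 + cmod z) / 2.
have zp : cmod z < p by rewrite /p; lra.
have p1 : p < 1 by rewrite /p; lra.
have p0 : 0 <= p := le_trans (cmod_ge0 z) (ltW zp).
pose K := M * (1 - p) ^- 3.
have K0 : 0 <= K by rewrite mulr_ge0// invr_ge0 exprn_ge0// subr_ge0 ltW.
have taylor (h : C) : cmod h < p - cmod z ->
    cmod (F (z + h) - F z - h * D z) <= K * cmod h ^+ 2.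
  move=> hp.
  have zhp : cmod (z + h) <= p.
    by rewrite (le_trans (cmodD _ _))// -lerBrDl ltW.
  have zhd : unit_disc (z + h) by rewrite unit_discE (le_lt_trans zhp).
  have c1 : (fun n => power_series u (z + h) n.+2) @ \oo --> F (z + h).
    by have := uF _ zhd; rewrite -(cvg_shiftn 2); under eq_fun do rewrite addn2.
  have c2 : (fun n => power_series u z n.+2) @ \oo --> F z.
    by have := uF _ zd; rewrite -(cvg_shiftn 2); under eq_fun do rewrite addn2.
  have c3 : (fun n => h * power_series (fun n => n.+1%:R * u n.+1) z n.+1) @ \oo
      --> h * D z.
    apply: cvgMl_tmp.
    by have := uD _ zd; rewrite -(cvg_shiftn 1); under eq_fun do rewrite addn1.
  (* The index of the derived series is one lower, so that exponents match; those below 2 cancel. *)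
  have partialE n : power_series u (z + h) n.+2 - power_series u z n.+2 -
      h * power_series (fun n => n.+1%:R * u n.+1) z n.+1 = \sum_(i < n) u i.+2 *
      ((z + h) ^+ i.+2 - z ^+ i.+2 - i.+2%:R * z ^+ i.+1 * h).
    elim: n => [|n IH].
      rewrite /power_series /series/= !big_nat_recl// !big_geq// big_ord0.
      by rewrite !expr1 !expr0; ring.
    rewrite big_ord_recr/= -IH /power_series !(seriesSr _ n.+2) 
      (seriesSr (fun i => i.+1%:R * u i.+1 * z ^+ i) n.+1).
    by rewrite /=; ring.
  rewrite -cmodN -sub0r; apply: (cvg_cmod_le (cvgB (cvgB c1 c2) c3)).
  apply: nearW => n; rewrite sub0r cmodN.
  rewrite [X in cmod X](_ : _ = \sum_(i < n) u i.+2 *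
      ((z + h) ^+ i.+2 - z ^+ i.+2 - i.+2%:R * z ^+ i.+1 * h)); last first.
    exact: partialE.
  rewrite (le_trans (cmod_sum _ _ _))//.
  apply: (@le_trans _ _ (M * binsum 3 n p * cmod h ^+ 2)).
    rewrite -mulrA mulr_suml mulr_sumr ler_sum// => i _.
    by rewrite cmodM ler_pM ?cmod_ge0// exprD_taylor2// ltW.
  rewrite ler_wpM2r ?exprn_ge0 ?cmod_ge0// ler_wpM2l//.
  have := @binrem_ge0 R 3 n p; rewrite p0 p1 => /(_ isT).
  rewrite /binrem subr_ge0; apply: le_trans.
  by rewrite /binsum big_ord_recr/= lerDl mulr_ge0 ?bincoef_ge0 ?exprn_ge0.
apply/cvg_lim; first exact: norm_hausdorff.
apply/cvgCP => e e0.
pose r := Num.min (p - cmod z) (e / (K + 1)).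
have r0 : 0 < r by rewrite lt_min subr_gt0 zp divr_gt0// ltr_wpDl.
have near0 : \forall h \near (0 : C)^', h != 0 /\ cmod h < r.
  exists r%:C => /=; first by rewrite ltcR.
  by move=> h /=; rewrite sub0r normrN normCE ltcR => hr h0; split.
apply: filterS near0 => h [h0]; rewrite lt_min => /andP[hp he].
have hn0 : 0 < cmod h by rewrite cmod_gt0.
rewrite [X in cmod X](_ : _ = - (h^-1 * (F (z + h) - F z - h * D z))); last first.
  rewrite /GRing.scale/= (addrC h z) !mulrBr mulrA mulVf// mul1r; ring.
rewrite cmodN cmodM cmodV mulrC ltr_pdivrMr// (le_lt_trans (taylor _ hp))//.
rewrite expr2 mulrA ltr_pM2r//.
have : cmod h * (K + 1) < e by rewrite -ltr_pdivlMr ?ltr_wpDl.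
by apply: le_lt_trans; rewrite mulrC ler_wpM2l ?cmod_ge0// lerDl.
Qed.

End power_series_derivative.

(** * A coefficient criterion for membership in the class *)

Section convexity_criterion.
Context {R : realType}.
Local Notation C := (Cfield R).

(** The bound is asked only at [n.+1]: in the application the empty partial sum lacks the constant
    term that is subtracted. *)
Lemma cvg_cmodD_le (u1 u2 : nat -> C) (l1 l2 : C) (k M : R) : 0 <= k ->
  u1 @ \oo --> l1 -> u2 @ \oo --> l2 ->
  (forall n, cmod (u1 n.+1) + k * cmod (u2 n.+1) <= M) ->
  cmod l1 + k * cmod l2 <= M.
Proof.
move=> k0 /cvgCP h1 /cvgCP h2 uM; apply/ler_addgt0Pr => e e0.
pose d := e / (1 + k).
have k1 : 0 < 1 + k by rewrite ltr_pwDl.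
have d0 : 0 < d by rewrite divr_gt0.
have [N1 _ hN1] := h1 d d0; have [N2 _ hN2] := h2 d d0.
pose n := maxn N1 N2.
have := hN1 n.+1 (leqW (leq_maxl _ _)); have := hN2 n.+1 (leqW (leq_maxr _ _)).
move=> /= d2 d1.
have e1 : cmod l1 <= d + cmod (u1 n.+1).
  by rewrite -{1}(subrK (u1 n.+1) l1) (le_trans (cmodD _ _))// lerD2r ltW.
have e2 : cmod l2 <= d + cmod (u2 n.+1).
  by rewrite -{1}(subrK (u2 n.+1) l2) (le_trans (cmodD _ _))// lerD2r ltW.
have ed : e = d + k * d by rewrite /d; field; rewrite gt_eqF.
have := uM n; have := ler_wpM2l k0 e2; rewrite mulrDr ed; lra.
Qed.

Lemma convex_class_criterion (lambda : R) (v : nat -> C) (T : nat -> R)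
    (f : C -> C) :
  0 < lambda -> v 0%N = 1 -> (forall n, cmod (v n) <= T n) -> T 0%N = 1 ->
  (forall n, \sum_(i < n) i.+1%:R * (i%:R + lambda) * T i <= 2 * lambda) ->
  (forall z, unit_disc z -> f z = z * limn (power_series v z)) ->
  convex_class lambda f.
Proof.
move=> l0 v0 vT T0 hT fE.
have Tge0 n : 0 <= T n := le_trans (cmod_ge0 _) (vT n).
have term_ge0 n : 0 <= n.+1%:R * (n%:R + lambda) * T n.
  by rewrite !mulr_ge0// addr_ge0// ltW.
have term_le n : n.+1%:R * (n%:R + lambda) * T n <= 2 * lambda.
  apply: le_trans (hT n.+1); rewrite big_ord_recr/= lerDr.
  by rewrite sumr_ge0.
(* For [n >= 1], [(n+1)^2 <= 2 n (n+1)], so [(n+1)^2 T n <= 4 lambda]; the 1 covers [T 0 = 1].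
   Bounded coefficients, even after two factors [n + 1], permit both termwise differentiations. *)
pose M := 4 * lambda + 1.
have TM n : n.+1%:R * (n.+1%:R * T n) <= M.
  case: n => [|n]; first by rewrite T0 !mul1r /M lerDr mulr_ge0// ltW.
  have := term_le n.+1; have := Tge0 n.+1; move: (T n.+1) => t t0.
  have : 0 <= n%:R :> R by [].
  rewrite -[n.+2%:R]natr1 -natr1; move: (n%:R) => x x0; rewrite /M.
  have h : 0 <= (x + 1 + 1) * t * lambda by rewrite !mulr_ge0// ?addr_ge0// ltW.
  have h' : 0 <= x * t by rewrite mulr_ge0.
  have h'' : 0 <= x * (x * t) by rewrite mulr_ge0.
  by nra.
pose p n := n.+1%:R * v n.
pose q n := n.+1%:R * p n.
have qM n : cmod (q n) <= M.
  rewrite /q /p !cmodM cmod_nat; apply: le_trans (TM n).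
  by rewrite !ler_wpM2l.
have pM n : cmod (p n) <= M.
  apply: le_trans (qM n); rewrite /q cmodM cmod_nat ler_peMl ?cmod_ge0//.
  by rewrite ler1n.
have vM n : cmod (v n) <= M.
  apply: le_trans (pM n); rewrite /p cmodM cmod_nat ler_peMl ?cmod_ge0//.
  by rewrite ler1n.
have lim_cvg (u : nat -> C) z : (forall n, cmod (u n) <= M) -> unit_disc z ->
    power_series u z @ \oo --> limn (power_series u z).
  move=> uM zd; have [l ul] := bounded_power_series_cvg uM zd.
  by apply/cvg_ex; exists l.
pose P z := limn (power_series p z).
pose Q z := limn (power_series q z).
pose u1 n : C := if n is m.+1 then v m else 0.
pose u2 n : C := if n is m.+1 then p m else 0.
have M0 : 0 <= M := le_trans (cmod_ge0 _) (vM 0%N).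
have u1M n : cmod (u1 n) <= M by case: n => [|n] //=; rewrite cmod0.
have u2M n : cmod (u2 n) <= M by case: n => [|n] //=; rewrite cmod0.
have u1f z : unit_disc z -> power_series u1 z @ \oo --> f z.
  by move=> zd; rewrite fE//; apply: power_series_shift; exact: lim_cvg.
have df z : unit_disc z -> derive1 f z = P z.
  by apply: (derive1_power_series u1M u1f) => {}z zd; exact: lim_cvg.
pose g z := z * derive1 f z.
have u2g z : unit_disc z -> power_series u2 z @ \oo --> g z.
  by move=> zd; rewrite /g df//; apply: power_series_shift; exact: lim_cvg.
have dg z : unit_disc z -> derive1 g z = Q z.
  by apply: (derive1_power_series u2M u2g) => {}z zd; exact: lim_cvg.
have tail n : \sum_(i < n) i.+2%:R * (i.+1%:R + lambda) * T i.+1 <= lambda.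
  by have := hT n.+1; rewrite big_ord_recl/= T0 add0r !mul1r mulr1; lra.
split; first by exists u1; split => //.
split; first by exists u2; split => //; rewrite /= /p v0 mulr1.
move=> z zd z0.
have x1 : cmod z < 1 by rewrite -unit_discE.
have x0 : 0 <= cmod z := cmod_ge0 z.
(* Both series start at exponent 1, which frees one factor [|z|] and makes the final inequality
   strict. *)
have key : cmod (Q z - P z) + lambda * cmod (P z - 1) <= cmod z * lambda.
  have cP := lim_cvg p z pM zd; have cQ := lim_cvg q z qM zd.
  have c1 : (fun n => power_series q z n - power_series p z n) @ \oo -->
    Q z - P z by exact: (cvgB cQ cP).
  have c2 : (fun n => power_series p z n - 1) @ \oo --> P z - 1.
    exact: (cvgB cP (cvg_cst (1 : C))).
  apply: (cvg_cmodD_le (ltW l0) c1 c2) => n.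
  have p0 : p 0%N = 1 by rewrite /p v0 mulr1.
  have q0 : q 0%N = 1 by rewrite /q p0 mulr1.
  have e2 : power_series p z n.+1 - 1 = \sum_(i < n) p i.+1 * z ^+ i.+1.
    rewrite /power_series /series/= big_nat_recl// big_mkord p0 expr0 mulr1.
    by rewrite addrAC subrr add0r.
  have e1 : power_series q z n.+1 - power_series p z n.+1 =
      \sum_(i < n) i.+1%:R * p i.+1 * z ^+ i.+1.
    rewrite /power_series /series/= !big_nat_recl// !big_mkord p0 q0 expr0 mulr1.
    rewrite opprD addrACA subrr add0r -sumrB; apply: eq_bigr => i _.
    by rewrite /q -[i.+2%:R]natr1; ring.
  rewrite e1 e2 (le_trans (lerD (cmod_sum _ _ _)
    (ler_wpM2l (ltW l0) (cmod_sum _ _ _))))//.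
  rewrite mulr_sumr -big_split/=.
  rewrite (le_trans _ (ler_wpM2l x0 (tail n)))// mulr_sumr ler_sum// => i _.
  have eP : cmod (p i.+1 * z ^+ i.+1) =
      cmod z ^+ i.+1 * (i.+2%:R * cmod (v i.+1)).
    by rewrite cmodM cmodX /p cmodM cmod_nat mulrC.
  rewrite -mulrA cmodM cmod_nat eP exprS.
  have xi : cmod z ^+ i * cmod (v i.+1) <= T i.+1.
    rewrite -[leRHS]mul1r ler_pM ?cmod_ge0 ?exprn_ge0// exprn_ile1// ltW//.
  have h : 0 <= i.+2%:R * (i.+1%:R + lambda) * cmod z.
    by rewrite !mulr_ge0// addr_ge0// ltW.
  have := ler_wpM2l h xi; set L := (X in X <= _ -> _); set L' := (X in _ <= X -> _).
  rewrite (_ : _ + _ = L); last by rewrite /L; ring.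
  by rewrite (_ : cmod z * _ = L')// /L'; ring.
have PQ : cmod (Q z - P z) < lambda * cmod (P z).
  have : 1 <= cmod (P z - 1) + cmod (P z).
    rewrite -(cmod1 (R := R)) cmodB -{1}(subrK (P z) 1).
    exact: cmodD.
  have := cmod_ge0 (Q z - P z); nra.
have P0 : P z != 0.
  by rewrite -cmod_gt0 -(pmulr_rgt0 _ l0) (le_lt_trans _ PQ) ?cmod_ge0.
split; first by rewrite df// mulf_neq0.
suff : `|z * Q z / (z * P z) - 1| < lambda%:C.
  by rewrite -(dg z zd) -(df z zd).
rewrite (_ : z * Q z / (z * P z) - 1 = (Q z - P z) / P z); last first.
  by field; rewrite ?z0 ?P0.
by rewrite normCE ltcR cmodM cmodV ltr_pdivrMr ?cmod_gt0.
Qed.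

End convexity_criterion.

(** * Reduction of the weighted sum to three values of 2F1 *)

Section clausen_moments.
Context {R : realType}.
Local Notation C := (Cfield R).

Lemma series_cvg_shift (f : nat -> R) (l : R) : f 0%N = 0 ->
  series (fun n => f n.+1) @ \oo --> l -> series f @ \oo --> l.
Proof.
move=> f0 fl; rewrite -cvg_shiftS.
rewrite (_ : (fun n => _) = series (fun n => f n.+1))//.
by apply/funext => n; rewrite /series/= big_nat_recl// f0 add0r.
Qed.

(** The factor [m + 1] cancels in the factorial; the first factor of [(a)_(m+1)] and the first two
    of the other symbols split off. *)
Lemma clausen_term_shift (a b c : R) m : 0 < c ->
  m.+1%:R * clausen_term a b c m.+1 =
  a * pochhammer b 2 / pochhammer c 2 * clausen_term (a + 1) (b + 2) (c + 2) m.
Proof.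
move=> c0; rewrite /clausen_term.
have e2 (x : R) : pochhammer x (2 * m.+1) = pochhammer x 2 * pochhammer (x + 2) (2 * m).
  rewrite mulnS !addSn add0n !pochhammerSl pochhammer0 mulr1 mulrA.
  by rewrite -addrA.
rewrite !e2 pochhammerSl [pochhammer 1 m.+1]pochhammerS -nat1r.
have /lt0r_neq0 := pochhammer_gt0 2 c0.
have /lt0r_neq0 := @pochhammer_gt0 R (c + 2) (2 * m) ltac:(by rewrite addr_gt0).
have := pochhammer1_neq0 R m.
have : 1 + m%:R != 0 :> R by rewrite gt_eqF// ltr_wpDr.
by move=> ? ? ? ?; field; apply/and4P; split.
Qed.

Lemma clausen_moments_lim (a b c lambda l0 l1 l2 : R) : 0 < c ->
  let k1 := a * pochhammer b 2 / pochhammer c 2 in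
  let k2 := (a + 1) * pochhammer (b + 2) 2 / pochhammer (c + 2) 2 in
  series (clausen_term a b c) @ \oo --> l0 ->
  series (clausen_term (a + 1) (b + 2) (c + 2)) @ \oo --> l1 ->
  series (clausen_term (a + 1 + 1) (b + 2 + 2) (c + 2 + 2)) @ \oo --> l2 ->
  series (fun m => m.+1%:R * (m%:R + lambda) * clausen_term a b c m) @ \oo -->
  k1 * (k2 * l2) + (lambda + 2) * (k1 * l1) + lambda * l0.
Proof.
move=> c0 k1 k2 S0 S1 S2.
have M1 : series (fun m => m%:R * clausen_term a b c m) @ \oo --> k1 * l1.
  apply: series_cvg_shift; first by rewrite mul0r.
  rewrite (_ : series _ = (fun n => k1 * series (clausen_term (a + 1) (b + 2) (c + 2)) n)).
    by apply: cvgMl_tmp; exact: S1.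
  apply/funext => n; rewrite /series/= mulr_sumr; apply: eq_bigr => m _.
  exact: clausen_term_shift.
have M2 : series (fun m => m%:R * (m%:R - 1) * clausen_term a b c m) @ \oo -->
    k1 * (k2 * l2).
  (* The weight [m (m - 1)] vanishes at 0 and at 1, which allows two shifts. *)
  apply: series_cvg_shift; first by rewrite !mul0r.
  apply: series_cvg_shift; first by rewrite subrr mulr0 mul0r.
  rewrite (_ : series _ = (fun n => k1 * (k2 *
      series (clausen_term (a + 1 + 1) (b + 2 + 2) (c + 2 + 2)) n))).
    by apply: cvgMl_tmp; apply: cvgMl_tmp; exact: S2.
  apply/funext => n; rewrite /series/= !mulr_sumr; apply: eq_bigr => m _.
  rewrite [X in X * _]mulrC -mulrA clausen_term_shift//.
  rewrite -[m.+2%:R]natr1 addrK mulrCA clausen_term_shift ?addr_gt0//.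
rewrite (_ : series _ = (fun n =>
    series (fun m => m%:R * (m%:R - 1) * clausen_term a b c m) n +
    (lambda + 2) * series (fun m => m%:R * clausen_term a b c m) n +
    lambda * series (clausen_term a b c) n)).
  by apply: cvgD; [apply: cvgD => //; exact: cvgMl_tmp|exact: cvgMl_tmp].
apply/funext => n; rewrite /series/= !mulr_sumr -!big_split/=.
by apply: eq_bigr => m _; rewrite -natr1; ring.
Qed.

Definition gamma_quotient (a b c : R) : R :=
  Gamma c * Gamma (c - a - b) / (Gamma (c - a) * Gamma (c - b)).

(** Under the shift [c - b] is unchanged, [c - a] gains 1 and [c - a - b] loses 1. The last change
    uses the functional equation at [c - a - b - 1], which must be positive. *)
Lemma gamma_quotient_shift (a b c : R) : 0 < a -> 0 < b -> a + b + 1 < c ->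
  a * pochhammer b 2 / pochhammer c 2 * gamma_quotient (a + 1) (b + 2) (c + 2) =
  gamma_quotient a b c * (a * pochhammer b 2 / ((c - a) * (c - a - b - 1))).
Proof.
move=> a0 b0 abc; rewrite /gamma_quotient.
have c0 : 0 < c by lra.
have ca0 : 0 < c - a by lra.
have cb0 : 0 < c - b by lra.
have cab0 : 0 < c - a - b - 1 by lra.
rewrite (_ : c + 2 - (a + 1) - (b + 2) = c - a - b - 1); last by ring.
rewrite (_ : c + 2 - (a + 1) = c - a + 1); last by ring.
rewrite (_ : c + 2 - (b + 2) = c - b); last by ring.
rewrite (Gamma_pochhammer 2 c0) (GammaS ca0).
rewrite -[c - a - b](subrK 1) (GammaS cab0) addrK.
have /lt0r_neq0 := pochhammer_gt0 2 c0.
have /lt0r_neq0 := Gamma_gt0 ca0. have /lt0r_neq0 := Gamma_gt0 cb0.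
move: (Gamma _) (Gamma _) (Gamma _) (Gamma _) (pochhammer b 2) (pochhammer c 2).
move=> g1 g2 g3 g4 p1 p2 ? ? ?.
by field; do ?[apply/andP; split] => //; rewrite gt_eqF.
Qed.

Lemma pochhammer2 (x : R) : pochhammer x 2 = x * (x + 1).
Proof. by rewrite !pochhammerS pochhammer0 addr0 mul1r. Qed.

Lemma clausen_moments (a b c lambda : R) : 0 < a -> 0 < b -> a + b + 2 < c ->
  let F (x y w : R) := complex.Re (hyp2F1 (x%:C : C) y%:C w%:C (-1)) in
  series (fun m => m.+1%:R * (m%:R + lambda) * clausen_term a b c m) @ \oo -->
  Gamma c * Gamma (c - a - b) / (Gamma (c - a) * Gamma (c - b)) *
    (pochhammer a 2 * pochhammer b 4 /
       (pochhammer (c - a) 2 * pochhammer (c - a - b - 2) 2) *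
       F (a + 2) (b + 4) (c - a + 2)
     + (lambda + 2) * a * pochhammer b 2 / ((c - a) * (c - a - b - 1)) *
       F (a + 1) (b + 2) (c - a + 1)
     + lambda * F a b (c - a)).
Proof.
move=> a0 b0 abc F.
have c0 : 0 < c by lra.
have a1 : 0 < a + 1 by lra.
have a2 : 0 < a + 1 + 1 by lra.
have b1 : 0 < b + 2 by lra.
have b2 : 0 < b + 2 + 2 by lra.
have h0 : a + b < c by lra.
have h1 : a + 1 + (b + 2) < c + 2 by lra.
have h2 : a + 1 + 1 + (b + 2 + 2) < c + 2 + 2 by lra.
have h3 : a + b + 1 < c by lra.
have h4 : a + 1 + (b + 2) + 1 < c + 2 by lra.
have e1 := gamma_quotient_shift a0 b0 h3.
have e2 := gamma_quotient_shift a1 b1 h4.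
have S0 : series (clausen_term a b c) @ \oo -->
    gamma_quotient a b c * F a b (c - a) by exact: clausen_series.
have S1 : series (clausen_term (a + 1) (b + 2) (c + 2)) @ \oo -->
    gamma_quotient (a + 1) (b + 2) (c + 2) * F (a + 1) (b + 2) (c - a + 1).
  rewrite (_ : c - a + 1 = c + 2 - (a + 1)); last by ring.
  exact: clausen_series.
have S2 : series (clausen_term (a + 1 + 1) (b + 2 + 2) (c + 2 + 2)) @ \oo -->
    gamma_quotient (a + 1 + 1) (b + 2 + 2) (c + 2 + 2) *
    F (a + 2) (b + 4) (c - a + 2).
  rewrite (_ : c - a + 2 = c + 2 + 2 - (a + 1 + 1)); last by ring.
  rewrite [in F _](_ : a + 2 = a + 1 + 1); last by ring.
  rewrite [in F _ _](_ : b + 4 = b + 2 + 2); last by ring.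
  exact: clausen_series.
have := clausen_moments_lim (lambda := lambda) c0 S0 S1 S2.
move: {S0 S1 S2} (F a b (c - a)) (F (a + 1) (b + 2) (c - a + 1))
  (F (a + 2) (b + 4) (c - a + 2)) => F0 F1 F2.
move: e1 e2; rewrite /=; set k1 := a * _ / pochhammer c 2.
set k2 := (a + 1) * _ / pochhammer (c + 2) 2.
rewrite -[_ / _ in X in _ -> _ -> _ -> X]/(gamma_quotient a b c).
set g0 := gamma_quotient a b c; set g1 := gamma_quotient (a + 1) _ _.
set g2 := gamma_quotient (a + 1 + 1) _ _ => e1 e2.
set L := (X in _ --> X -> _); set L' := (X in _ -> _ --> X).
suff -> : L = L' by [].
rewrite {}/L {}/L'.
rewrite (_ : k1 * (k2 * (g2 * F2)) = k1 * (k2 * g2) * F2); last by ring.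
rewrite (_ : k1 * (g1 * F1) = k1 * g1 * F1); last by ring.
(* The second shift is undone first: [e2] turns [k2 * g2] into a multiple of [g1], to which [e1]
   applies. *)
rewrite e2 mulrA e1.
rewrite (_ : pochhammer b 4 = pochhammer b 2 * pochhammer (b + 2) 2); last first.
  by rewrite !pochhammer2 !pochhammerSl pochhammer0; ring.
rewrite !pochhammer2.
field; do ?[apply/andP; split]; rewrite gt_eqF//; lra.
Qed.

End clausen_moments.

Section clausen_coefficients.

(** Factors of even and of odd index are separated, with a 2 taken out of each. *)
Lemma pochhammer_double (K : numFieldType) (x : K) n :
  pochhammer x (2 * n) = 4 ^+ n * (pochhammer (x / 2) n * pochhammer ((x + 1) / 2) n).
Proof.
elim: n => [|n IH]; first by rewrite muln0 !pochhammer0 !mul1r.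
rewrite mulnS !addSn add0n !pochhammerS IH exprS mul2n -addnn -[_.+1%:R]natr1 natrD.
by field.
Qed.

Context {R : realType}.
Local Notation C := (Cfield R).

Lemma cmod_pochhammer_le (a : C) n : cmod (pochhammer a n) <= pochhammer (cmod a) n.
Proof.
elim: n => [|n IH]; first by rewrite !pochhammer0 cmod1.
rewrite !pochhammerS cmodM ler_pM ?cmod_ge0//.
by rewrite (le_trans (cmodD _ _))// cmod_nat.
Qed.

(** The powers of 4 from the two duplications cancel. The denominators are positive reals, so only
    the numerators are estimated. *)
Lemma cmod_coef3F2_le (a b : C) (c : R) n : 0 < c ->
  cmod (coef3F2 a (b / 2) ((b + 1) / 2) (c / 2)%:C ((c + 1) / 2)%:C n) <=
  clausen_term (cmod a) (cmod b) c n.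
Proof.
move=> c0; pose f : {rmorphism R -> C} := real_complex R.
have c2 : 0 < c / 2 by rewrite divr_gt0.
have c12 : 0 < (c + 1) / 2 by rewrite divr_gt0// addr_gt0.
have h4 : 4 ^+ n != 0 :> C by rewrite expf_neq0// pnatr_eq0.
rewrite (_ : coef3F2 _ _ _ _ _ _ =
    pochhammer a n / (pochhammer (1 : R) n)%:C *
    (pochhammer b (2 * n) / (pochhammer c (2 * n))%:C)); last first.
  rewrite /coef3F2 !pochhammer_double -[1]/(f 1).
  rewrite -!(pochhammer_rmorph f) !rmorphM/= rmorphXn/= rmorph_nat.
  have : f (pochhammer (c / 2) n) != 0.
    by rewrite fmorph_eq0 gt_eqF// pochhammer_gt0.
  have : f (pochhammer ((c + 1) / 2) n) != 0.
    by rewrite fmorph_eq0 gt_eqF// pochhammer_gt0.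
  have : f (pochhammer 1 n) != 0 by rewrite fmorph_eq0 pochhammer1_neq0.
  move=> /= ? ? ?; field; do ?[apply/andP; split] => //.
rewrite /clausen_term !cmodM !cmodV !cmodR !ger0_norm ?pochhammer_ge0 ?(ltW c0)//.
rewrite ler_pM ?mulr_ge0 ?cmod_ge0 ?invr_ge0 ?pochhammer_ge0 ?(ltW c0)//.
- by rewrite ler_wpM2r ?invr_ge0 ?pochhammer_ge0// cmod_pochhammer_le.
- by rewrite ler_wpM2r ?invr_ge0 ?pochhammer_ge0 ?(ltW c0)// cmod_pochhammer_le.
Qed.

End clausen_coefficients.

Theorem theorem3p1 (R : realType) (a b : Cfield R) (c lambda : R)
  (a_neq0 : a != 0) (b_neq0 : b != 0)
  (c_gt0 : 0 < c) (c_gt : cmod a + cmod b + 2 < c)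
  (lambda_gt0 : 0 < lambda) (lambda_le1 : lambda <= 1)
  (hyp :
    let A := cmod a in
    let B := cmod b in
    (* the parameters and the argument being real, so are these values *)
    let F (x y w : R) : R := complex.Re (hyp2F1 x%:C y%:C w%:C (-1)) in
    Gamma c * Gamma (c - A - B) / (Gamma (c - A) * Gamma (c - B)) *
    (pochhammer A 2 * pochhammer B 4 /
       (pochhammer (c - A) 2 * pochhammer (c - A - B - 2) 2) *
       F (A + 2) (B + 4) (c - A + 2)
     + (lambda + 2) * A * pochhammer B 2 / ((c - A) * (c - A - B - 1)) *
       F (A + 1) (B + 2) (c - A + 1)
     + lambda * F A B (c - A))
    <= 2 * lambda) :
  convex_class lambda
    (fun z : Cfield R =>
       z * hyp3F2 a (b / 2) ((b + 1) / 2) (c / 2)%:C ((c + 1) / 2)%:C z).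
Proof.
have A0 : 0 < cmod a by rewrite cmod_gt0.
have B0 : 0 < cmod b by rewrite cmod_gt0.
have moments := clausen_moments (lambda := lambda) A0 B0 c_gt.
apply: (@convex_class_criterion _ _
  (coef3F2 a (b / 2) ((b + 1) / 2) (c / 2)%:C ((c + 1) / 2)%:C)
  (clausen_term (cmod a) (cmod b) c)) => //.
- by rewrite /coef3F2 !pochhammer0 !mulr1 divr1.
- by move=> n; exact: cmod_coef3F2_le.
- by rewrite /clausen_term muln0 !pochhammer0 !divr1 mulr1.
move=> n; apply: le_trans hyp.
(* The terms are nonnegative, so each partial sum is below the limit, which is the left-hand side of
   [hyp]. *)
have nd : nondecreasing_seq (series (fun m =>
    m.+1%:R * (m%:R + lambda) * clausen_term (cmod a) (cmod b) c m)).
  apply/nondecreasing_seqP => m; rewrite seriesSr lerDl.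
  apply: mulr_ge0; first by rewrite mulr_ge0// addr_ge0// ltW.
  by apply: clausen_term_ge0; exact: ltW.
have := nondecreasing_cvgn_le nd (cvgP _ moments) n.
by rewrite (cvg_lim _ moments)// /series/= big_mkord.
Qed.
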